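(* Let $m>0$. There exists $\varepsilon_0>0$ such that for every $\omega$ with $0<\omega<m$ and $m-\omega<\varepsilon_0$ there exist real-valued functions $\Phi_1,\Phi_2$ on $(0,\infty)$, not both identically zero, and positive functions $A,T$ on $(0,\infty)$ satisfying, on $(0,\infty)$, $$\sqrt{A}\,\Phi_1'=\frac{1}{r}\Phi_1-(\omega T+m)\Phi_2,$$ $$\sqrt{A}\,\Phi_2'=(\omega T-m)\Phi_1-\frac{1}{r}\Phi_2,$$ $$rA'=1-A-16\pi\omega T^2\left(\Phi_1^2+\Phi_2^2\right),$$ $$2rA\frac{T'}{T}=A-1-16\pi\omega T^2\left(\Phi_1^2+\Phi_2^2\right)+32\pi\frac{1}{r}T\Phi_1\Phi_2+16\pi mT\left(\Phi_1^2-\Phi_2^2\right),$$ together with $\lim_{r\to\infty}T(r)=1$ and $\lim_{r\to\infty}\frac{r}{2}(1-A(r))<\infty$.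
   Context: A prime denotes $d/dr$. The system is the coupled Einstein-Dirac system for a static, spherically symmetric system of two fermions of mass $m$ in a singlet spinor state, with metric $g_{ij}=\mathrm{diag}\left(T^{-2},-A^{-1},-r^2,-r^2\sin^2\vartheta\right)$, where $A=A(r)$ and $T=T(r)$ are positive functions and $\Phi_1(r),\Phi_2(r)$ are radial real functions describing the wave function. The condition $\lim_{r\to\infty}T(r)=1$ says that the metric is asymptotically Minkowskian, and the condition $\lim_{r\to\infty}\frac r2(1-A(r))<\infty$ says that the (ADM) mass is finite. No normalization of $\int_0^\infty (\Phi_1^2+\Phi_2^2)\frac{T}{\sqrt A}\,dr$ is imposed. *)

(* Defs.v *)
From Stdlib Require Import Reals.
From Coquelicot Require Import Coquelicot.
Open Scope R_scope.

(* Radial functions on (0, oo) are total functions R -> R of which only the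
   values at r > 0 are constrained. *)

Record is_einstein_dirac_solution (m omega : R) (Phi1 Phi2 A T : R -> R) : Prop := {
  ed_A_pos : forall r, 0 < r -> 0 < A r;
  ed_T_pos : forall r, 0 < r -> 0 < T r;
  ed_Phi1_diff : forall r, 0 < r -> ex_derive Phi1 r;
  ed_Phi2_diff : forall r, 0 < r -> ex_derive Phi2 r;
  ed_A_diff : forall r, 0 < r -> ex_derive A r;
  ed_T_diff : forall r, 0 < r -> ex_derive T r;
  ed_dirac1 : forall r, 0 < r ->
    sqrt (A r) * Derive Phi1 r = 1 / r * Phi1 r - (omega * T r + m) * Phi2 r;
  ed_dirac2 : forall r, 0 < r ->
    sqrt (A r) * Derive Phi2 r = (omega * T r - m) * Phi1 r - 1 / r * Phi2 r;
  ed_einstein1 : forall r, 0 < r ->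
    r * Derive A r
    = 1 - A r - 16 * PI * omega * (T r) ^ 2 * ((Phi1 r) ^ 2 + (Phi2 r) ^ 2);
  ed_einstein2 : forall r, 0 < r ->
    2 * r * A r * (Derive T r / T r)
    = A r - 1 - 16 * PI * omega * (T r) ^ 2 * ((Phi1 r) ^ 2 + (Phi2 r) ^ 2)
      + 32 * PI * (1 / r) * T r * Phi1 r * Phi2 r
      + 16 * PI * m * T r * ((Phi1 r) ^ 2 - (Phi2 r) ^ 2)
}.

Definition asymptotically_minkowskian (T : R -> R) : Prop :=
  is_lim T p_infty 1.

(* The limit is required to exist in R; since (r (1 - A))' >= 0 along solutions
   with omega > 0, a limit equal to -oo is impossible anyway. *)
Definition finite_adm_mass (A : R -> R) : Prop :=
  ex_finite_lim (fun r => r / 2 * (1 - A r)) p_infty.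

(* Main.v *)
Require Import Defs.
From Stdlib Require Import Reals Lra Psatz.
From Coquelicot Require Import Coquelicot.
Open Scope R_scope.

(* Nothing is required at [r = 0], so we look for solutions with negative ADM mass, which have
   [A = 1 + la / (m r)] with [la > 0] everywhere and hence no horizon.  With [r = x^2 / m] the
   background [T = A^(-1/2)] of negative Schwarzschild mass is smooth up to [x = 0].  Twice the
   polar angle of [(Phi1, Phi2)], measured from [atan (1 / (m r))], satisfies a scalar equation
   that is uniformly expanding outwards on an interval [[del, PI - del]], so it can be solved from
   infinity inside that interval; there the density [Phi1^2 + Phi2^2] decays exponentially.  The
   fermions act back on the metric with a factor [eps] proportional to the density at [r = 0], so
   for small [eps] the whole system, integrated from infinity, is the fixed point of a
   contraction. *)

(** With [a = sqrt A] and [TH] twice the polar angle, the Dirac equations read [a TH' = 2 (omega T -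
    m cos TH - sin TH / r)] and, for the logarithm of the density,
    [a LL' = 2 (cos TH / r - m sin TH)]: the angle feels the density only through the metric.
    Writing [m cos TH + sin TH / r] as a multiple of [cos (TH - atan (1 / (m r)))] explains the
    reference direction, and the same shift makes [LL'] a negative multiple of the sine. At infinity
    the shifted angle has the equilibrium [cos th = omega / m], repelling outwards; this is where
    [omega < m] enters, and the sine is positive there, so the density decays. Following the bounded
    solution inwards is therefore stable, and since the origin carries no boundary condition, no
    shooting is left to do. On the metric side [m r (A - 1)] has a derivative proportional to the
    density, and adding the Einstein equations cancels [1 - A], so [sqrt A T] is constant up to
    fermionic terms. Both are thus within [O(eps)] of constants, and the free amplitude of the
    spinor lets [eps] be chosen last. *)

(** * Contraction principle in a weighted sup distance *)

(** Pointwise bounds [d * wt x] stand in for a distance, so no supremum norm or complete function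
    space has to be built. The iterates are Cauchy uniformly relative to [wt], and closedness of [S]
    is asked only for such uniform limits. *)
Lemma banach_fixed_point (X : Type) (wt : X -> R) (S : (X -> R) -> Prop)
  (P : (X -> R) -> X -> R) (q d0 : R) (u0 : X -> R) :
  0 <= q < 1 -> (forall x, 0 <= wt x) -> 0 <= d0 ->
  (forall u, S u -> S (P u)) ->
  (forall u v d, S u -> S v -> 0 <= d ->
     (forall x, Rabs (u x - v x) <= d * wt x) ->
     forall x, Rabs (P u x - P v x) <= q * d * wt x) ->
  S u0 -> (forall x, Rabs (P u0 x - u0 x) <= d0 * wt x) ->
  (forall (un : nat -> X -> R) v, (forall n, S (un n)) ->
     (forall e, 0 < e -> exists n, forall x, Rabs (un n x - v x) <= e * wt x) -> S v) ->
  exists v, S v /\ forall x, P v x = v x.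
Proof.
intros Hq Hwt Hd0 HP Hc HS0 Hu0 Hcl.
set (un := fix un n := match n with O => u0 | Datatypes.S n => P (un n) end).
assert (HSn : forall n, S (un n)) by (induction n; simpl; auto).
assert (Hqn : forall n, 0 <= q ^ n) by (intro; apply pow_le; lra).
assert (Hstep : forall n x, Rabs (un (Datatypes.S n) x - un n x) <= q ^ n * d0 * wt x).
{ induction n; intro x.
  - simpl. rewrite Rmult_1_l. apply Hu0.
  - change (q ^ Datatypes.S n) with (q * q ^ n).
    replace (q * q ^ n * d0 * wt x) with (q * (q ^ n * d0) * wt x) by ring.
    apply (Hc (un (Datatypes.S n)) (un n)); auto.
    apply Rmult_le_pos; auto. }
assert (Hdist : forall n k x,
   Rabs (un (n + k)%nat x - un n x) <= q ^ n * (d0 / (1 - q)) * wt x).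
(* The geometric sum is kept as [q ^ n - q ^ (n + k)], which is what makes the induction on [k]
   close. *)
{ assert (H : forall n k x, Rabs (un (n + k)%nat x - un n x)
      <= (q ^ n - q ^ (n + k)) * (d0 / (1 - q)) * wt x).
  { intros n k x. induction k.
    - rewrite Nat.add_0_r, !Rminus_diag, Rabs_R0. lra.
    - rewrite Nat.add_succ_r.
      replace (un (Datatypes.S (n + k)) x - un n x) with
        ((un (Datatypes.S (n + k)) x - un (n + k)%nat x) + (un (n + k)%nat x - un n x)) by ring.
      eapply Rle_trans; [apply Rabs_triang|].
      eapply Rle_trans; [apply Rplus_le_compat; [apply Hstep|apply IHk]|].
      right. simpl. field. lra. }
  intros n k x. eapply Rle_trans; [apply H|].
  apply Rmult_le_compat_r; auto. apply Rmult_le_compat_r.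
  - apply Rdiv_le_0_compat; lra.
  - specialize (Hqn (n + k)%nat); lra. }
assert (Hsmall : forall e, 0 < e -> exists n, forall x k,
   Rabs (un (n + k)%nat x - un n x) <= e * wt x).
{ intros e He.
  destruct (pow_lt_1_zero q) with (y := e / (d0 / (1 - q) + 1)) as [N HN].
  - rewrite Rabs_pos_eq; lra.
  - apply Rdiv_lt_0_compat; auto. assert (0 <= d0 / (1 - q)) by (apply Rdiv_le_0_compat; lra). lra.
  - exists N. intros x k. eapply Rle_trans; [apply Hdist|].
    apply Rmult_le_compat_r; auto.
    specialize (HN N (Nat.le_refl _)). rewrite Rabs_pos_eq in HN by auto.
    assert (Hp : 0 <= d0 / (1 - q)) by (apply Rdiv_le_0_compat; lra).
    set (D := d0 / (1 - q)) in *.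
    apply Rle_trans with (e / (D + 1) * D).
    + apply Rmult_le_compat_r; lra.
    + apply Rle_trans with (e / (D + 1) * (D + 1)).
      * apply Rmult_le_compat_l; [apply Rdiv_le_0_compat; lra|lra].
      * right; field; lra. }
assert (Hex : forall x, ex_finite_lim_seq (fun n => un n x)).
{ intro x. apply ex_lim_seq_cauchy_corr. intros [e He].
  destruct (Hsmall (e / 4 / (wt x + 1))) as [N HN].
  { apply Rdiv_lt_0_compat; [lra|specialize (Hwt x); lra]. }
  assert (HN' : forall n, (N <= n)%nat -> Rabs (un n x - un N x) < e / 2).
  { intros n Hn. replace n with (N + (n - N))%nat by lia.
    eapply Rle_lt_trans; [apply HN|].
    apply Rle_lt_trans with (e / 4 / (wt x + 1) * (wt x + 1)).
    - apply Rmult_le_compat_l; [|lra]. apply Rdiv_le_0_compat; [lra|specialize (Hwt x); lra].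
    - replace (e / 4 / (wt x + 1) * (wt x + 1)) with (e / 4) by (field; specialize (Hwt x); lra). lra. }
  exists N. intros n k Hn Hk. simpl.
  replace (un n x - un k x) with ((un n x - un N x) - (un k x - un N x)) by ring.
  specialize (HN' n Hn) as H1. specialize (HN' k Hk) as H2.
  apply Rabs_def2 in H1. apply Rabs_def2 in H2. apply Rabs_def1; lra. }
set (v := fun x => real (Lim_seq (fun n => un n x))).
assert (Hv : forall x, is_lim_seq (fun n => un n x) (v x)).
{ intro x. apply Lim_seq_correct'. apply Hex. }
assert (Hnv : forall e, 0 < e -> exists n, forall k x,
   Rabs (un (n + k)%nat x - v x) <= e * wt x).
{ intros e He. destruct (Hsmall (e / 2)) as [n Hn]; [lra|]. exists n. intros k x.
  assert (Hl : is_lim_seq (fun k => un (k + n)%nat x) (v x))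
    by exact (proj1 (is_lim_seq_incr_n (fun k => un k x) n (v x)) (Hv x)).
  apply (is_lim_seq_le (fun j => Rabs (un (n + k)%nat x - un (j + n)%nat x)) (fun _ => e * wt x)
           (Rabs (un (n + k)%nat x - v x)) (e * wt x)); [| |apply is_lim_seq_const].
  - intro j. rewrite (Nat.add_comm j).
    replace (un (n + k)%nat x - un (n + j)%nat x) with
        ((un (n + k)%nat x - un n x) + - (un (n + j)%nat x - un n x)) by ring.
    eapply Rle_trans; [apply Rabs_triang|]. rewrite Rabs_Ropp.
    generalize (Hn x k) (Hn x j). lra.
  - apply (is_lim_seq_abs _ (Finite (un (n + k)%nat x - v x))).
    apply is_lim_seq_minus'; [apply is_lim_seq_const|exact Hl]. }
assert (HSv : S v).
{ apply Hcl with un; auto. intros e He. destruct (Hnv e He) as [n Hn].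
  exists n. intro x. generalize (Hn O x). now rewrite Nat.add_0_r. }
exists v. split; auto. intro x.
assert (Hsmallv : forall e, 0 < e -> Rabs (P v x - v x) <= e * (2 * wt x)).
{ intros e He. destruct (Hnv e He) as [n Hn].
  assert (H1 : Rabs (P (un n) x - P v x) <= q * e * wt x).
  { apply Hc; auto; [lra|]. intro y. generalize (Hn O y). now rewrite Nat.add_0_r. }
  assert (H2 := Hn 1%nat x). rewrite Nat.add_1_r in H2. change (un (Datatypes.S n) x) with (P (un n) x) in H2.
  replace (P v x - v x) with ((P (un n) x - v x) + - (P (un n) x - P v x)) by ring.
  eapply Rle_trans; [apply Rabs_triang|]. rewrite Rabs_Ropp.
  assert (q * e * wt x <= 1 * e * wt x).
  { apply Rmult_le_compat_r; auto. apply Rmult_le_compat_r; lra. }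
  lra. }
apply Rminus_diag_uniq.
destruct (Req_dec (P v x - v x) 0) as [|Hne]; auto. exfalso.
apply Rabs_pos_lt in Hne. specialize (Hwt x).
assert (H := Hsmallv (Rabs (P v x - v x) / (2 * (2 * wt x + 1)))
   ltac:(apply Rdiv_lt_0_compat; lra)).
assert (Rabs (P v x - v x) / (2 * (2 * wt x + 1)) * (2 * wt x + 1) = Rabs (P v x - v x) / 2) by (field; lra).
assert (0 < Rabs (P v x - v x) / (2 * (2 * wt x + 1))) by (apply Rdiv_lt_0_compat; lra).
nra.
Qed.

(** * Antiderivatives vanishing at infinity *)

Lemma derive_nonpos_decreasing (F dF : R -> R) (a b : R) :
  a <= b -> (forall x, a <= x -> is_derive F x (dF x)) ->
  (forall x, a <= x -> dF x <= 0) -> F b <= F a.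
Proof.
intros Hab HF Hd.
destruct (MVT_gen F a b dF) as [c [Hc Heq]]; rewrite ?Rmin_left, ?Rmax_right in * by auto.
- intros x Hx. apply HF. lra.
- intros x Hx. apply continuity_pt_filterlim.
  apply (ex_derive_continuous F). exists (dF x). apply HF. lra.
- specialize (Hd c (proj1 Hc)). nra.
Qed.

(** A nonincreasing function stays above its limit. This is how inequalities between derivatives are
    integrated inwards from infinity. *)
Lemma derive_nonpos_lim0_nonneg (F dF : R -> R) :
  (forall x, 0 <= x -> is_derive F x (dF x)) ->
  (forall x, 0 <= x -> dF x <= 0) -> is_lim F p_infty 0 ->
  forall x, 0 <= x -> 0 <= F x.
Proof.
intros HF Hd Hlim x Hx.
apply (is_lim_le_loc F (fun _ => F x) p_infty 0 (F x)); [|auto|apply is_lim_const].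
exists x. intros y Hy. apply derive_nonpos_decreasing with dF; intros; try apply HF; try apply Hd; lra.
Qed.

(** The improper integral of [f] from [x] to infinity. In this form its derivative requires only
    continuity of [f]; convergence matters only for the limit at infinity. *)
Definition tail (f : R -> R) (x : R) : R :=
  real (Lim (fun y => RInt f 0 y) p_infty) - RInt f 0 x.

Lemma is_derive_RInt_from_0 (f : R -> R) (x : R) :
  (forall y, continuous f y) -> is_derive (fun y => RInt f 0 y) x (f x).
Proof.
intro Hf. apply (is_derive_RInt f (fun y => RInt f 0 y) 0 x); [|apply Hf].
apply filter_forall. intro y. apply (RInt_correct (V := R_CompleteNormedModule)).
apply (ex_RInt_continuous (V := R_CompleteNormedModule)). auto.
Qed.

Lemma RInt_0_0 (f : R -> R) : RInt f 0 0 = 0.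
Proof. exact (RInt_point (V := R_CompleteNormedModule) 0 f). Qed.

Lemma is_derive_tail (f : R -> R) (x : R) :
  (forall y, continuous f y) -> is_derive (tail f) x (- f x).
Proof.
intro Hf. unfold tail.
replace (- f x) with (0 - f x) by ring.
apply (is_derive_minus (fun _ => real (Lim (fun y => RInt f 0 y) p_infty)) (fun y => RInt f 0 y)).
- exact (is_derive_const (V := R_NormedModule) (real (Lim (fun y => RInt f 0 y) p_infty)) x).
- now apply is_derive_RInt_from_0.
Qed.

(** Increments of the integral are dominated by increments of [G], so the Cauchy criterion for [G]
    passes to the integral. *)
Lemma is_lim_tail (f g G : R -> R) (l : R) :
  (forall y, continuous f y) -> (forall x, 0 <= x -> is_derive G x (g x)) ->
  (forall x, 0 <= x -> Rabs (f x) <= g x) -> is_lim G p_infty l ->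
  is_lim (tail f) p_infty 0.
Proof.
intros Hf HG Hfg Hlim.
set (J := fun y => RInt f 0 y).
assert (HJ : forall x, is_derive J x (f x)) by (intro; now apply is_derive_RInt_from_0).
assert (Hcmp : forall x y, 0 <= x <= y -> Rabs (J y - J x) <= G y - G x).
{ intros x y Hxy.
  assert (H1 : J y - G y <= J x - G x).
  { apply (derive_nonpos_decreasing (fun t => J t - G t) (fun t => f t - g t)); [lra| |].
    - intros t Ht. apply (is_derive_minus J G); [auto|apply HG; lra].
    - intros t Ht. generalize (Hfg t ltac:(lra)) (Rle_abs (f t)). lra. }
  assert (H2 : - J y - G y <= - J x - G x).
  { apply (derive_nonpos_decreasing (fun t => - J t - G t) (fun t => - f t - g t)); [lra| |].
    - intros t Ht. apply (is_derive_minus (fun t => - J t) G); [|apply HG; lra].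
      apply (is_derive_opp J). auto.
    - intros t Ht. generalize (Hfg t ltac:(lra)) (Rle_abs (- f t)). rewrite Rabs_Ropp. lra. }
  apply Rabs_le. lra. }
assert (Hex : exists L, filterlim J (Rbar_locally p_infty) (locally L)).
{ apply (proj1 (filterlim_locally_cauchy (U := R_CompleteSpace) (F := Rbar_locally p_infty) J)).
  intros e. apply is_lim_spec in Hlim. simpl in Hlim.
  destruct (Hlim (pos_div_2 e)) as [N HN]. simpl in HN.
  exists (fun x => Rmax N 0 < x). split.
  - exists (Rmax N 0). auto.
  - intros u v Hu Hv.
    assert (Hmx := Rmax_l N 0). assert (Hmx' := Rmax_r N 0).
    assert (HGu := HN u ltac:(lra)). assert (HGv := HN v ltac:(lra)).
    apply Rabs_def2 in HGu. apply Rabs_def2 in HGv.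
    change (Rabs (J v - J u) < e).
    destruct (Rle_dec u v).
    + eapply Rle_lt_trans; [apply Hcmp; lra|]. lra.
    + rewrite Rabs_minus_sym. eapply Rle_lt_trans; [apply Hcmp; lra|]. lra. }
destruct Hex as [L HL].
assert (HJL : is_lim J p_infty L) by exact HL.
unfold tail. fold J. rewrite (is_lim_unique _ _ _ HJL). simpl.
replace (Finite 0) with (Finite (L - L)) by (f_equal; ring).
apply (is_lim_minus' (fun _ => L) J p_infty L L); [apply is_lim_const|exact HJL].
Qed.

(** * Estimates with the weight [exp (- c * K)] *)

Section ExponentialWeight.

Context (k K : R -> R).
Context (dK : forall x, is_derive K x (k x)).
Context (K_oo : is_lim K p_infty p_infty).

Lemma is_derive_exp_K (c x : R) :
  is_derive (fun y => exp (- c * K y)) x (- c * k x * exp (- c * K x)).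
Proof.
assert (H := dK x).
evar_last.
- apply (is_derive_comp exp (fun y => - c * K y)).
  + apply is_derive_exp.
  + apply (is_derive_scal K x (- c) (k x)), H.
- unfold scal; simpl; unfold mult; simpl. ring.
Qed.

Lemma is_lim_exp_K (c : R) : 0 < c -> is_lim (fun y => exp (- c * K y)) p_infty 0.
Proof.
intro Hc.
apply is_lim_comp with m_infty.
- apply is_lim_exp_m.
- evar_last.
  + apply is_lim_scal_l. exact K_oo.
  + simpl. destruct (Rle_dec 0 (- c)) as [Hle|Hle]; [exfalso; lra|]; reflexivity.
- exists 0. intros; discriminate.
Qed.

Lemma is_lim_tail_exp (f : R -> R) (c C : R) :
  0 < c -> (forall y, continuous f y) ->
  (forall x, 0 <= x -> Rabs (f x) <= C * (k x * exp (- c * K x))) ->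
  is_lim (tail f) p_infty 0.
Proof.
intros Hc Hf Hb.
apply is_lim_tail with (g := fun x => C * (k x * exp (- c * K x)))
  (G := fun x => - (C / c) * exp (- c * K x)) (l := 0); auto.
- intros x _. evar_last.
  + apply is_derive_scal. apply is_derive_exp_K.
  + simpl. field. lra.
- evar_last.
  + apply is_lim_scal_l. now apply is_lim_exp_K.
  + simpl. f_equal. ring.
Qed.

(** The majorant [C / c * exp (- c * K x)] also vanishes at infinity and has minus the bound on [f]
    as its derivative; it is compared from infinity with both [F] and [- F]. *)
Lemma lim0_derive_bound (F f : R -> R) (c C : R) :
  0 < c -> (forall x, 0 <= x -> is_derive F x (f x)) -> is_lim F p_infty 0 ->
  (forall x, 0 <= x -> Rabs (f x) <= C * (k x * exp (- c * K x))) ->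
  forall x, 0 <= x -> Rabs (F x) <= C / c * exp (- c * K x).
Proof.
intros Hc HF Hlim Hb.
assert (Hg : forall s, is_lim (fun x => C / c * exp (- c * K x) + s * F x) p_infty 0).
{ intro s. replace (Finite 0) with (Finite (C / c * 0 + s * 0)) by (f_equal; ring).
  apply (is_lim_plus' (fun x => C / c * exp (- c * K x)) (fun x => s * F x)).
  - apply (is_lim_scal_l _ (C / c) p_infty 0). now apply is_lim_exp_K.
  - apply (is_lim_scal_l F s p_infty 0). exact Hlim. }
assert (Hmain : forall s, s = 1 \/ s = -1 -> forall x, 0 <= x ->
   0 <= C / c * exp (- c * K x) + s * F x).
{ intros s Hs.
  apply derive_nonpos_lim0_nonneg with
    (dF := fun x => - (C * (k x * exp (- c * K x))) + s * f x).
  - intros x Hx.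
    apply (is_derive_plus (fun x => C / c * exp (- c * K x)) (fun x => s * F x)).
    + evar_last.
      * apply is_derive_scal. apply is_derive_exp_K.
      * simpl. field. lra.
    + apply is_derive_scal. auto.
  - intros x Hx. generalize (Hb x Hx) (Rle_abs (f x)) (Rle_abs (- f x)). rewrite Rabs_Ropp.
    destruct Hs; subst s; lra.
  - apply Hg. }
intros x Hx. apply Rabs_le.
generalize (Hmain 1 (or_introl eq_refl) x Hx) (Hmain (-1) (or_intror eq_refl) x Hx). lra.
Qed.

Lemma derive_bound_from_0 (F f : R -> R) (C : R) :
  K 0 = 0 -> (forall x, 0 <= x -> is_derive F x (f x)) -> F 0 = 0 ->
  (forall x, 0 <= x -> f x <= C * k x) ->
  forall x, 0 <= x -> F x <= C * K x.
Proof.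
intros HK HF H0 Hb x Hx.
assert (H : F x - C * K x <= F 0 - C * K 0).
{ apply (derive_nonpos_decreasing (fun t => F t - C * K t) (fun t => f t - C * k t)); auto.
  - intros t Ht. apply (is_derive_minus F (fun t => C * K t)); auto.
    apply is_derive_scal. apply dK.
  - intros t Ht. generalize (Hb t Ht). lra. }
rewrite H0, HK in H. lra.
Qed.

End ExponentialWeight.

(** * Elementary Lipschitz estimates *)

Lemma sin_ge_between (a x : R) : 0 <= a <= PI / 2 -> a <= x <= PI - a -> sin a <= sin x.
Proof.
intros Ha Hx. assert (Hpi := PI_RGT_0).
destruct (Rle_dec x (PI / 2)).
- apply sin_incr_1; lra.
- rewrite <- (sin_PI_x x). apply sin_incr_1; lra.
Qed.

(* The gain [sin a / 2] over the trivial constant [1] makes the angle equation contract. *)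
Lemma add_cos_lipschitz (a b x y : R) :
  0 <= a <= PI / 2 -> 1 / 2 <= b <= 1 -> a <= x <= PI - a -> a <= y <= PI - a ->
  Rabs ((x + b * cos x) - (y + b * cos y)) <= (1 - sin a / 2) * Rabs (x - y).
Proof.
intros Ha Hb Hx Hy.
destruct (MVT_gen (fun t => t + b * cos t) y x (fun t => 1 - b * sin t)) as [c [Hc Heq]].
- intros t _. auto_derive; auto. ring.
- intros t _. apply continuity_pt_filterlim.
  apply (ex_derive_continuous (fun t => t + b * cos t)). auto_derive. auto.
- rewrite Heq, Rabs_mult. apply Rmult_le_compat_r; [apply Rabs_pos|].
  assert (a <= c <= PI - a).
  { revert Hc. unfold Rmin, Rmax. destruct (Rle_dec y x); lra. }
  assert (Hs := sin_ge_between a c Ha H).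
  assert (Hs1 := SIN_bound c).
  assert (0 <= sin a) by (apply sin_ge_0; lra).
  rewrite Rabs_pos_eq; nra.
Qed.

Lemma cos_lipschitz (x y : R) : Rabs (cos x - cos y) <= Rabs (x - y).
Proof.
destruct (MVT_gen cos y x (fun t => - sin t)) as [c [Hc Heq]].
- intros t _. auto_derive; auto. ring.
- intros t _. apply continuity_pt_filterlim. apply (ex_derive_continuous cos). auto_derive. auto.
- rewrite Heq, Rabs_mult, Rabs_Ropp. rewrite <- (Rmult_1_l (Rabs (x - y))) at 2.
  apply Rmult_le_compat_r; [apply Rabs_pos|]. apply Rabs_le, SIN_bound.
Qed.

Lemma sin_lipschitz (x y : R) : Rabs (sin x - sin y) <= Rabs (x - y).
Proof.
rewrite <- (cos_shift x), <- (cos_shift y).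
eapply Rle_trans; [apply cos_lipschitz|].
rewrite <- Rabs_Ropp. right. f_equal. ring.
Qed.

Lemma exp_le_compat (x y : R) : x <= y -> exp x <= exp y.
Proof. intros [H| ->]; [left; now apply exp_increasing|lra]. Qed.

Lemma exp_lipschitz (m x y : R) : x <= m -> y <= m ->
  Rabs (exp x - exp y) <= exp m * Rabs (x - y).
Proof.
assert (H : forall x y, x <= y -> y <= m -> exp y - exp x <= exp m * (y - x)).
{ clear. intros x y Hxy Hy.
  assert (H1 := exp_ineq1_le (x - y)).
  assert (H2 : exp y * exp (x - y) = exp x) by (rewrite <- exp_plus; f_equal; ring).
  assert (H3 := exp_le_compat y m Hy).
  assert (H4 := exp_pos y). nra. }
intros Hx Hy. destruct (Rle_dec x y) as [Hxy|Hxy].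
- rewrite Rabs_minus_sym, (Rabs_minus_sym x). assert (H1 := exp_le_compat x y Hxy).
  rewrite !Rabs_pos_eq by lra. apply H; lra.
- assert (H1 := exp_le_compat y x ltac:(lra)). rewrite !Rabs_pos_eq by lra. apply H; lra.
Qed.

(** * Calculus of bounds and Lipschitz constants *)

(** Size and Lipschitz constant travel together because the constant of a product needs both. The
    distance [d] between two states is kept apart, so that [A] and [C] do not depend on the
    states. *)
Definition bounded_close (A C d u v : R) : Prop :=
  Rabs u <= A /\ Rabs v <= A /\ Rabs (u - v) <= C * d.

Lemma bounded_close_mult (A C A' C' d u v u' v' : R) :
  bounded_close A C d u v -> bounded_close A' C' d u' v' ->
  bounded_close (A * A') (A * C' + A' * C) d (u * u') (v * v').
Proof.
intros [H1 [H2 H3]] [H1' [H2' H3']].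
repeat split; try (rewrite Rabs_mult; apply Rmult_le_compat; auto using Rabs_pos).
replace (u * u' - v * v') with (u * (u' - v') + v' * (u - v)) by ring.
eapply Rle_trans; [apply Rabs_triang|]. rewrite !Rabs_mult, Rmult_plus_distr_r, !Rmult_assoc.
apply Rplus_le_compat; apply Rmult_le_compat; auto using Rabs_pos.
Qed.

Lemma bounded_close_plus (A C A' C' d u v u' v' : R) :
  bounded_close A C d u v -> bounded_close A' C' d u' v' ->
  bounded_close (A + A') (C + C') d (u + u') (v + v').
Proof.
intros [H1 [H2 H3]] [H1' [H2' H3']].
repeat split; try (eapply Rle_trans; [apply Rabs_triang|]; now apply Rplus_le_compat).
replace (u + u' - (v + v')) with ((u - v) + (u' - v')) by ring.
eapply Rle_trans; [apply Rabs_triang|]. rewrite Rmult_plus_distr_r. now apply Rplus_le_compat.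
Qed.

Lemma bounded_close_const (A d u : R) : Rabs u <= A -> bounded_close A 0 d u u.
Proof. intro H. repeat split; auto. rewrite Rminus_diag, Rabs_R0. lra. Qed.

Lemma bounded_close_opp (A C d u v : R) :
  bounded_close A C d u v -> bounded_close A C d (- u) (- v).
Proof.
intros [H1 [H2 H3]]. repeat split; rewrite ?Rabs_Ropp; auto.
replace (- u - - v) with (- (u - v)) by ring. now rewrite Rabs_Ropp.
Qed.

Lemma bounded_close_pow (A C d u v : R) (n : nat) :
  bounded_close A C d u v -> bounded_close (A ^ S n) (INR (S n) * A ^ n * C) d (u ^ S n) (v ^ S n).
Proof.
intro H. induction n as [|n IHn].
- replace (A ^ 1) with A by ring. replace (INR 1 * A ^ 0 * C) with C by (simpl; ring).
  now rewrite !pow_1.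
- replace (INR (S (S n)) * A ^ S n * C) with (A * (INR (S n) * A ^ n * C) + A ^ S n * C)
    by (rewrite !S_INR; simpl; ring).
  now apply (bounded_close_mult A C (A ^ S n) (INR (S n) * A ^ n * C) d u v (u ^ S n) (v ^ S n)).
Qed.

(** * Continuity of real functions *)

Lemma continuous_uniform_limit (f : R -> R) :
  (forall e, 0 < e -> exists g : R -> R,
     (forall x, continuous g x) /\ forall x, Rabs (g x - f x) <= e) ->
  forall x, continuous f x.
Proof.
intros H x. apply filterlim_locally. intros [e He].
destruct (H (e / 4)) as [g [Hg Hgf]]; [lra|].
assert (Hgx := proj1 (filterlim_locally g (g x)) (Hg x) (pos_div_2 (mkposreal e He))).
revert Hgx; apply filter_imp. intros y Hy.
change (Rabs (g y - g x) < e / 2) in Hy. change (Rabs (f y - f x) < e).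
generalize (Hgf x) (Hgf y). intros H1 H2.
apply Rabs_le_between in H1. apply Rabs_le_between in H2. apply Rabs_def2 in Hy.
apply Rabs_def1; lra.
Qed.
Lemma le_of_approx (a b : R) : (forall e, 0 < e -> a <= b + e) -> a <= b.
Proof. intro H. destruct (Rle_dec a b) as [|Hn]; auto. specialize (H ((a - b) / 2)). lra. Qed.

Lemma continuous_Rplus (f g : R -> R) (x : R) :
  continuous f x -> continuous g x -> continuous (fun y => f y + g y) x.
Proof. exact (continuous_plus (V := R_NormedModule) f g x). Qed.

Lemma continuous_Ropp (f : R -> R) (x : R) :
  continuous f x -> continuous (fun y => - f y) x.
Proof. exact (continuous_opp (V := R_NormedModule) f x). Qed.

Lemma continuous_Rminus (f g : R -> R) (x : R) :
  continuous f x -> continuous g x -> continuous (fun y => f y - g y) x.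
Proof. exact (continuous_minus (V := R_NormedModule) f g x). Qed.

Lemma continuous_Rmult (f g : R -> R) (x : R) :
  continuous f x -> continuous g x -> continuous (fun y => f y * g y) x.
Proof. exact (continuous_mult (K := R_AbsRing) f g x). Qed.

Lemma continuous_pow (f : R -> R) (n : nat) (x : R) :
  continuous f x -> continuous (fun y => f y ^ n) x.
Proof.
intro Hf. induction n; simpl; [apply continuous_const|now apply continuous_Rmult].
Qed.

Lemma continuous_compR (f g : R -> R) (x : R) :
  continuous f x -> (forall y, continuous g y) -> continuous (fun y => g (f y)) x.
Proof. intros Hf Hg. exact (continuous_comp f g x Hf (Hg (f x))). Qed.

Lemma continuous_Rmax0 (f : R -> R) (x : R) :
  (forall y, continuous f y) -> continuous (fun y => f (Rmax 0 y)) x.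
Proof.
intro Hf. apply (continuous_compR (fun y => Rmax 0 y) f); auto.
apply (continuous_ext (fun y => (y + Rabs y) / 2)).
- intro y. unfold Rmax, Rabs. destruct (Rcase_abs y), (Rle_dec 0 y); lra.
- apply (continuous_Rmult (fun y => y + Rabs y) (fun _ => / 2)); [|apply continuous_const].
  apply continuous_Rplus; [apply continuous_id|apply continuous_Rabs].
Qed.

Lemma is_derive_continuousR (f : R -> R) (x l : R) : is_derive f x l -> continuous f x.
Proof. intro H. apply (ex_derive_continuous f). now exists l. Qed.

Ltac cont :=
  repeat match goal with
    | |- continuous (fun _ => ?c) _ => apply continuous_const
    | |- continuous (fun x => x) _ => apply continuous_id
    | |- continuous (fun x => _ + _) _ => apply continuous_Rplus
    | |- continuous (fun x => _ - _) _ => apply continuous_Rminus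
    | |- continuous (fun x => _ * _) _ => apply continuous_Rmult
    | |- continuous (fun x => - _) _ => apply continuous_Ropp
    | |- continuous (fun x => _ ^ _) _ => apply continuous_pow
    | |- continuous (fun x => exp _) _ => apply (continuous_compR _ exp); [|apply continuous_exp]
    | |- continuous (fun x => cos _) _ => apply (continuous_compR _ cos); [|apply continuous_cos]
    | |- continuous (fun x => sin _) _ => apply (continuous_compR _ sin); [|apply continuous_sin]
    | H : context [continuous _ _] |- _ => solve [simple apply H]
    end.

(** * The reduced system as a fixed point *)

(** The three unknown functions become a single function on [component * R], which fits the
    contraction principle and allows a separate weight for each of them. *)
Inductive component : Type := Angle | Mass | Lapse.

(* The reduced system in [x], with [K' = k]:
     th' = k (p ta b^2 - b cos th + q)
     L'  = - k b sin th
     la' = - eps k e^L p ta^2 b^2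
     ta' = eps k e^L be (ta^2 b^3 cos th / 2 - p ta^3 b^4)
   where [b = b x la], with [la -> M] and [ta -> 1] at infinity and [L 0 = 0]. *)
Section FixedPoint.

Context (k K p q be : R -> R) (b : R -> R -> R) (M eta del : R).
Context (k_cont : forall x, continuous k x) (k_pos : forall x, 0 < k x).
Context (dK : forall x, is_derive K x (k x)) (K_0 : K 0 = 0).
Context (K_oo : is_lim K p_infty p_infty).
Context (p_cont : forall x, continuous p x) (q_cont : forall x, continuous q x).
Context (be_cont : forall x, continuous be x).
Context (b_cont : forall la : R -> R, (forall x, continuous la x) ->
  (forall x, M <= la x) -> forall x, continuous (fun y => b y (la y)) x).
Context (M_pos : 0 < M) (eta_bd : 0 < eta <= 1) (del_bd : 0 < del <= PI / 2).
Context (p_bd : forall x, 0 <= x -> 0 <= p x <= 1).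
Context (q_pos : forall x, 0 <= x -> 0 <= q x).
Context (be_bd : forall x, 0 <= x -> Rabs (be x) <= 1 / M).
Context (b_bd : forall x la, M <= la <= 2 * M -> 1 / 2 <= b x la <= 1).
Context (b_lip : forall x la la', M <= la <= 2 * M -> M <= la' <= 2 * M ->
  Rabs (b x la - b x la') <= 1 / M * Rabs (la - la')).
(** The angle equation gives [th' <= 0] at [th = del]. At [PI - del] the cosine changes sign and all
    terms are nonnegative, so the flow leaves the interval at both ends. *)
Context (barrier : forall x la ta, 0 <= x -> M <= la <= 2 * M -> 1 - eta <= ta <= 1 + eta ->
  p x * ta * b x la ^ 2 - b x la * cos del + q x <= 0).

Definition angle_rhs (x th la ta : R) : R :=
  p x * ta * b x la ^ 2 - b x la * cos th + q x.
Definition mass_rhs (x la ta : R) : R := p x * ta ^ 2 * b x la ^ 2.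
(** The forms [* / 2] and [+ -] let the [bounded_close] lemmas for products, sums and opposites
    apply syntactically. *)
Definition lapse_rhs (x th la ta : R) : R :=
  be x * (ta ^ 2 * b x la ^ 3 * (cos th * / 2) + - (p x * ta ^ 3 * b x la ^ 4)).

(** The solution [L] of its equation with [L 0 = 0]. It is a functional of angle and mass and hence
    not a further unknown. *)
Definition log_density (u : component * R -> R) (x : R) : R :=
  - RInt (fun s => k s * (b s (u (Mass, s)) * sin (u (Angle, s)))) 0 x.

(** From [th' = k rhs] follows [(exp (- K) th)' = - exp (- K) k (th - rhs)], so a bounded angle is
    [exp K] times the tail of this source. Subtracting [rhs] turns the expansion rate [b sin th]
    into the factor [1 - b sin th < 1]. The exponent has the shape [- c * K] with [c = 1] to match
    the weighted estimates. *)
Definition angle_source (u : component * R -> R) (s : R) : R :=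
  exp (- (1) * K s) * k s * (u (Angle, s) - angle_rhs s (u (Angle, s)) (u (Mass, s)) (u (Lapse, s))).
Definition mass_source (u : component * R -> R) (s : R) : R :=
  k s * (exp (log_density u s) * mass_rhs s (u (Mass, s)) (u (Lapse, s))).
Definition lapse_source (u : component * R -> R) (s : R) : R :=
  k s * (exp (log_density u s) * lapse_rhs s (u (Angle, s)) (u (Mass, s)) (u (Lapse, s))).

(* Clamping the argument at [0] makes the bounds of [box] hold on all of [R]. *)
Definition integral_map (eps : R) (u : component * R -> R) (cx : component * R) : R :=
  let x := Rmax 0 (snd cx) in
  match fst cx with
  | Angle => exp (K x) * tail (angle_source u) x
  | Mass => M + tail (fun s => eps * mass_source u s) x
  | Lapse => 1 - tail (fun s => eps * lapse_source u s) x
  end.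

Definition box (u : component * R -> R) : Prop :=
  (forall c x, continuous (fun y => u (c, y)) x) /\
  (forall x, del <= u (Angle, x) <= PI - del /\ M <= u (Mass, x) <= 2 * M /\
     1 - eta <= u (Lapse, x) <= 1 + eta).

Lemma sin_del_pos : 0 < sin del <= 1.
Proof.
split; [apply sin_gt_0; generalize PI_RGT_0; lra|apply SIN_bound].
Qed.

Lemma K_pos (x : R) : 0 <= x -> 0 <= K x.
Proof.
intro Hx.
assert (H := derive_nonpos_decreasing (fun t => - K t) (fun t => - k t) 0 x Hx
  (fun t _ => is_derive_opp K t (k t) (dK t))).
simpl in H. rewrite K_0 in H.
assert (- K x <= - 0); [apply H; intros t _; specialize (k_pos t); lra|lra].
Qed.

(** * Density and sources of one state *)

Section OneState.

Context (u : component * R -> R) (Hu : box u).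

Let th_cont : forall x, continuous (fun y => u (Angle, y)) x := proj1 Hu Angle.
Let la_cont : forall x, continuous (fun y => u (Mass, y)) x := proj1 Hu Mass.
Let ta_cont : forall x, continuous (fun y => u (Lapse, y)) x := proj1 Hu Lapse.

Lemma box_b_cont (x : R) : continuous (fun y => b y (u (Mass, y))) x.
Proof. apply (b_cont (fun y => u (Mass, y))); auto. intro y. apply (proj2 Hu y). Qed.

Lemma is_derive_log_density (x : R) :
  is_derive (log_density u) x (- (k x * (b x (u (Mass, x)) * sin (u (Angle, x))))).
Proof.
assert (Hb := box_b_cont).
apply (is_derive_opp (fun y => RInt (fun s => k s * (b s (u (Mass, s)) * sin (u (Angle, s)))) 0 y)).
apply (is_derive_RInt_from_0 (fun s => k s * (b s (u (Mass, s)) * sin (u (Angle, s))))).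
intro y. cont.
Qed.

Lemma log_density_0 : log_density u 0 = 0.
Proof. unfold log_density. rewrite RInt_0_0. ring. Qed.

Lemma box_sin (x : R) : sin del <= sin (u (Angle, x)).
Proof. apply sin_ge_between; [lra|]. apply (proj2 Hu x). Qed.

(** The rate is the product of the lower bounds [1 / 2] for [b] and [sin del] for the sine. *)
Lemma log_density_le (x : R) : 0 <= x -> log_density u x <= - (sin del / 2) * K x.
Proof.
intro Hx. refine (derive_bound_from_0 k K dK (log_density u)
  (fun y => - (k y * (b y (u (Mass, y)) * sin (u (Angle, y))))) (- (sin del / 2)) K_0
  (fun y _ => is_derive_log_density y) log_density_0 _ x Hx).
intros y Hy. simpl. destruct (proj2 Hu y) as [H1 [H2 H3]].
assert (Hb := b_bd y _ H2). assert (Hs := box_sin y). assert (Hk := k_pos y).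
assert (Hd := sin_del_pos).
assert (1 / 2 * sin del <= b y (u (Mass, y)) * sin (u (Angle, y))) by (apply Rmult_le_compat; lra).
nra.
Qed.

Lemma log_density_cont (x : R) : continuous (log_density u) x.
Proof. exact (is_derive_continuousR _ _ _ (is_derive_log_density x)). Qed.

Lemma K_cont (x : R) : continuous K x.
Proof. exact (is_derive_continuousR _ _ _ (dK x)). Qed.

Lemma angle_source_cont (x : R) : continuous (angle_source u) x.
Proof.
assert (Hb := box_b_cont). assert (HK := K_cont).
unfold angle_source, angle_rhs. cont.
Qed.

Lemma mass_source_cont (x : R) : continuous (mass_source u) x.
Proof.
assert (Hb := box_b_cont). assert (HL := log_density_cont).
unfold mass_source, mass_rhs. cont.
Qed.

Lemma lapse_source_cont (x : R) : continuous (lapse_source u) x.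
Proof.
assert (Hb := box_b_cont). assert (HL := log_density_cont).
unfold lapse_source, lapse_rhs. cont.
Qed.

End OneState.

(** * Dependence of the density on the state *)

(** Half of the decay rate [sin del / 2] of the density; the other half absorbs a factor [K] in
    [density_close]. The contraction constant turns out to be [1 - decay]. *)
Definition decay : R := sin del / 4.
(** Chosen so that [rho * (1 + 5 / M) = sin del / 4]. If mass and lapse change by [rho d], then [b]
    changes by at most [rho d / M], and [ta b^2] by at most [(1 + 4 / M) rho d]. *)
Definition rho : R := sin del / (4 * (1 + 5 / M)).
Definition weight (cx : component * R) : R :=
  match fst cx with Angle => 1 | _ => rho end.
Definition close (d : R) (u v : component * R -> R) : Prop :=
  forall cx, Rabs (u cx - v cx) <= d * weight cx.

Lemma decay_pos : 0 < decay.
Proof. unfold decay. generalize sin_del_pos. lra. Qed.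

Lemma inv_M_pos : 0 < 1 / M.
Proof. apply Rdiv_lt_0_compat; lra. Qed.

Lemma rho_pos : 0 < rho.
Proof.
assert (H := inv_M_pos). unfold rho. apply Rdiv_lt_0_compat; [apply sin_del_pos|].
unfold Rdiv in *. lra.
Qed.

Section TwoStates.

Context (u v : component * R -> R) (d : R) (Hu : box u) (Hv : box v) (Huv : close d u v).

Lemma close_lapse (x : R) : bounded_close 2 rho d (u (Lapse, x)) (v (Lapse, x)).
Proof.
destruct (proj2 Hu x) as [_ [_ H1]]. destruct (proj2 Hv x) as [_ [_ H2]].
repeat split; try (apply Rabs_le; lra).
rewrite Rmult_comm. apply (Huv (Lapse, x)).
Qed.

Lemma close_b (x : R) :
  bounded_close 1 (1 / M * rho) d (b x (u (Mass, x))) (b x (v (Mass, x))).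
Proof.
destruct (proj2 Hu x) as [_ [H1 _]]. destruct (proj2 Hv x) as [_ [H2 _]].
assert (H3 := b_bd x _ H1). assert (H4 := b_bd x _ H2).
repeat split; try (apply Rabs_le; lra).
eapply Rle_trans; [apply b_lip; auto|]. rewrite Rmult_assoc.
apply Rmult_le_compat_l; [left; apply inv_M_pos|].
rewrite Rmult_comm. apply (Huv (Mass, x)).
Qed.

Lemma close_angle (x : R) : Rabs (u (Angle, x) - v (Angle, x)) <= d.
Proof. generalize (Huv (Angle, x)). unfold weight; simpl. lra. Qed.

Lemma close_cos (x : R) : bounded_close 1 1 d (cos (u (Angle, x))) (cos (v (Angle, x))).
Proof.
repeat split; try (apply Rabs_le, COS_bound).
eapply Rle_trans; [apply cos_lipschitz|]. generalize (close_angle x). lra.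
Qed.

Lemma close_sin (x : R) : bounded_close 1 1 d (sin (u (Angle, x))) (sin (v (Angle, x))).
Proof.
repeat split; try (apply Rabs_le, SIN_bound).
eapply Rle_trans; [apply sin_lipschitz|]. generalize (close_angle x). lra.
Qed.

Lemma log_density_close (x : R) : 0 <= x ->
  Rabs (log_density u x - log_density v x) <= (1 + 1 / M * rho) * d * K x.
Proof.
intro Hx.
assert (Hf : forall y, Rabs (k y * (b y (u (Mass, y)) * sin (u (Angle, y)))
    - k y * (b y (v (Mass, y)) * sin (v (Angle, y)))) <= (1 + 1 / M * rho) * d * k y).
{ intro y. destruct (bounded_close_mult _ _ _ _ _ _ _ _ _ (close_b y) (close_sin y)) as [_ [_ H]].
  rewrite <- Rmult_minus_distr_l, Rabs_mult, (Rabs_pos_eq (k y)) by (left; apply k_pos).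
  rewrite Rmult_comm. apply Rmult_le_compat_r; [left; apply k_pos|]. lra. }
assert (Hd : forall w z, box w -> box z -> forall y, is_derive (fun y => log_density w y - log_density z y) y
   (- (k y * (b y (w (Mass, y)) * sin (w (Angle, y))))
    - - (k y * (b y (z (Mass, y)) * sin (z (Angle, y)))))).
{ intros w z Hw Hz y. apply (is_derive_minus (log_density w) (log_density z));
    now apply is_derive_log_density. }
assert (H0 : forall w z, log_density w 0 - log_density z 0 = 0)
  by (intros; rewrite !log_density_0; ring).
assert (H1 := derive_bound_from_0 k K dK _ _ ((1 + 1 / M * rho) * d) K_0
  (fun y _ => Hd u v Hu Hv y) (H0 u v)).
assert (H2 := derive_bound_from_0 k K dK _ _ ((1 + 1 / M * rho) * d) K_0
  (fun y _ => Hd v u Hv Hu y) (H0 v u)).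
simpl in H1, H2.
assert (log_density u x - log_density v x <= (1 + 1 / M * rho) * d * K x).
{ apply H1; auto. intros y _. generalize (Hf y). rewrite Rabs_minus_sym.
  intro H. apply Rabs_le_between in H. lra. }
assert (log_density v x - log_density u x <= (1 + 1 / M * rho) * d * K x).
{ apply H2; auto. intros y _. generalize (Hf y). intro H3. apply Rabs_le_between in H3. lra. }
apply Rabs_le. lra.
Qed.

(** The logarithms differ by a multiple of [d * K x], which is unbounded. The inequality
    [decay * K <= exp (decay * K)] pays for the factor [K] with half of the decay. *)
Lemma density_close (x : R) : 0 <= x ->
  bounded_close (exp (- decay * K x)) (exp (- decay * K x) * ((1 + 1 / M * rho) / decay)) d
    (exp (log_density u x)) (exp (log_density v x)).
Proof.
intro Hx. assert (HK := K_pos x Hx). assert (Hc := decay_pos).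
assert (Hle : forall w, box w -> log_density w x <= - (2 * decay) * K x).
{ intros w Hw. generalize (log_density_le w Hw x Hx). unfold decay. lra. }
assert (Hle' : forall w, box w -> exp (log_density w x) <= exp (- decay * K x)).
{ intros w Hw. apply exp_le_compat. generalize (Hle w Hw). nra. }
repeat split.
- rewrite Rabs_pos_eq by (left; apply exp_pos). auto.
- rewrite Rabs_pos_eq by (left; apply exp_pos). auto.
- eapply Rle_trans; [apply exp_lipschitz; [apply Hle, Hu|apply Hle, Hv]|].
  assert (H1 := log_density_close x Hx).
  assert (H2 : decay * K x * exp (- (2 * decay) * K x) <= exp (- decay * K x)).
  { replace (- decay * K x) with (decay * K x + - (2 * decay) * K x) by ring.
    rewrite exp_plus. apply Rmult_le_compat_r; [left; apply exp_pos|].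
    generalize (exp_ineq1_le (decay * K x)). lra. }
  eapply Rle_trans; [apply Rmult_le_compat_l; [left; apply exp_pos|apply H1]|].
  replace (exp (- (2 * decay) * K x) * ((1 + 1 / M * rho) * d * K x)) with
    ((1 + 1 / M * rho) / decay * d * (decay * K x * exp (- (2 * decay) * K x))) by (field; lra).
  replace (exp (- decay * K x) * ((1 + 1 / M * rho) / decay) * d) with
    ((1 + 1 / M * rho) / decay * d * exp (- decay * K x)) by ring.
  apply Rmult_le_compat_l; auto.
  assert (Hd : 0 <= d) by (eapply Rle_trans; [apply Rabs_pos|apply (close_angle x)]).
  apply Rmult_le_pos; auto. apply Rdiv_le_0_compat; auto.
  assert (H3 := Rmult_lt_0_compat _ _ inv_M_pos rho_pos). lra.
Qed.

End TwoStates.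

(** * Sources of mass and lapse *)

(** Size and Lipschitz dependence are both dominated by the integrable function
    [k exp (- decay * K)], with constants uniform over the box. Multiplication by a small [eps] then
    makes the integral small and contracting. *)
Definition small_source (src : (component * R -> R) -> R -> R) (A C : R) : Prop :=
  0 <= A /\ 0 <= C /\
  (forall u, box u -> forall x, continuous (src u) x) /\
  (forall u, box u -> forall x, 0 <= x -> Rabs (src u x) <= A * (k x * exp (- decay * K x))) /\
  (forall u v d, box u -> box v -> close d u v -> forall x, 0 <= x ->
     Rabs (src u x - src v x) <= C * d * (k x * exp (- decay * K x))).

Lemma close_refl (u : component * R -> R) : close 0 u u.
Proof. intro cx. rewrite Rminus_diag, Rabs_R0. lra. Qed.

Lemma close_pos (d : R) (u v : component * R -> R) : close d u v -> 0 <= d.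
Proof. intro H. eapply Rle_trans; [apply Rabs_pos|apply (close_angle _ _ _ H 0)]. Qed.

Lemma small_source_intro (rhs : (component * R -> R) -> R -> R) (A C : R) :
  (forall u, box u -> forall x, continuous (fun s => k s * (exp (log_density u s) * rhs u s)) x) ->
  (forall u v d, box u -> box v -> close d u v -> forall x, 0 <= x ->
     bounded_close A C d (rhs u x) (rhs v x)) ->
  exists A' C', small_source (fun u s => k s * (exp (log_density u s) * rhs u s)) A' C'.
Proof.
intros Hcont Hrhs0.
assert (Hrhs : forall u v d, box u -> box v -> close d u v -> forall x, 0 <= x ->
     bounded_close (Rabs A) (Rabs C) d (rhs u x) (rhs v x)).
{ intros u v d Hu Hv Huv x Hx. destruct (Hrhs0 u v d Hu Hv Huv x Hx) as [H1 [H2 H3]].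
  assert (HA := Rle_abs A). repeat split; try lra.
  eapply Rle_trans; [apply H3|]. apply Rmult_le_compat_r; [apply (close_pos d u v Huv)|apply Rle_abs]. }
clear Hrhs0. assert (HA := Rabs_pos A). assert (HC := Rabs_pos C).
revert HA HC Hrhs. generalize (Rabs A) (Rabs C). clear A C. intros A C HA HC Hrhs.
exists A, (C + A * ((1 + 1 / M * rho) / decay)).
assert (Hp : 0 <= (1 + 1 / M * rho) / decay).
{ apply Rdiv_le_0_compat; [|apply decay_pos].
  assert (H3 := Rmult_lt_0_compat _ _ inv_M_pos rho_pos). lra. }
assert (H : forall u v d, box u -> box v -> close d u v -> forall x, 0 <= x ->
  bounded_close (exp (- decay * K x) * A) (exp (- decay * K x) * C
    + A * (exp (- decay * K x) * ((1 + 1 / M * rho) / decay))) d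
   (exp (log_density u x) * rhs u x) (exp (log_density v x) * rhs v x)).
{ intros u v d Hu Hv Huv x Hx. apply bounded_close_mult; auto. apply density_close; auto. }
repeat split; auto.
- assert (H1 := Rmult_le_pos _ _ HA Hp). lra.
- intros u Hu x Hx. destruct (H u u 0 Hu Hu (close_refl u) x Hx) as [H1 _].
  rewrite Rabs_mult, (Rabs_pos_eq (k x)) by (left; apply k_pos).
  eapply Rle_trans; [apply Rmult_le_compat_l; [left; apply k_pos|apply H1]|]. lra.
- intros u v d Hu Hv Huv x Hx. destruct (H u v d Hu Hv Huv x Hx) as [_ [_ H1]].
  rewrite <- Rmult_minus_distr_l, Rabs_mult, (Rabs_pos_eq (k x)) by (left; apply k_pos).
  eapply Rle_trans; [apply Rmult_le_compat_l; [left; apply k_pos|apply H1]|]. lra.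
Qed.

Lemma mass_source_small : exists A C, small_source mass_source A C.
Proof.
eapply (small_source_intro (fun u s => mass_rhs s (u (Mass, s)) (u (Lapse, s)))).
- exact mass_source_cont.
- intros u v d Hu Hv Huv x Hx. unfold mass_rhs.
  assert (Ht := close_lapse u v d Hu Hv Huv x). assert (Hb := close_b u v d Hu Hv Huv x).
  assert (Hp : bounded_close 1 0 d (p x) (p x))
    by (apply bounded_close_const, Rabs_le; generalize (p_bd x Hx); lra).
  (* The constants are existential variables, read off from the shape of the polynomial. *)
  repeat (eassumption || apply bounded_close_pow || apply bounded_close_mult).
Qed.

Lemma lapse_source_small : exists A C, small_source lapse_source A C.
Proof.
eapply (small_source_intro (fun u s => lapse_rhs s (u (Angle, s)) (u (Mass, s)) (u (Lapse, s)))).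
- exact lapse_source_cont.
- intros u v d Hu Hv Huv x Hx. unfold lapse_rhs.
  assert (Ht := close_lapse u v d Hu Hv Huv x). assert (Hb := close_b u v d Hu Hv Huv x).
  assert (Hc := close_cos u v d Huv x).
  assert (Hp : bounded_close 1 0 d (p x) (p x))
    by (apply bounded_close_const, Rabs_le; generalize (p_bd x Hx); lra).
  assert (Hbe : bounded_close (1 / M) 0 d (be x) (be x)) by (apply bounded_close_const, be_bd, Hx).
  assert (H2 : bounded_close (Rabs (/ 2)) 0 d (/ 2) (/ 2)) by (apply bounded_close_const; lra).
  repeat (eassumption || apply bounded_close_pow || apply bounded_close_mult
     || apply bounded_close_plus || apply bounded_close_opp).
Qed.

Lemma tail_small (src : (component * R -> R) -> R -> R) (A C eps : R) :
  small_source src A C -> 0 < eps ->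
  (forall u, box u -> is_lim (tail (fun s => eps * src u s)) p_infty 0) /\
  (forall u, box u -> forall x, 0 <= x ->
     Rabs (tail (fun s => eps * src u s) x) <= eps * (A / decay)) /\
  (forall u v d, box u -> box v -> close d u v -> forall x, 0 <= x ->
     Rabs (tail (fun s => eps * src u s) x - tail (fun s => eps * src v s) x)
       <= eps * (C / decay) * d).
Proof.
intros [HA [HC [Hcont [Hbd Hlip]]]] He. assert (Hc := decay_pos).
assert (Hcont' : forall u, box u -> forall x, continuous (fun s => eps * src u s) x).
{ intros u Hu x. apply (continuous_Rmult (fun _ => eps)); [apply continuous_const|now apply Hcont]. }
assert (Habs : forall a c, Rabs a <= c -> Rabs (eps * a) <= eps * c).
{ intros a c H. rewrite Rabs_mult, (Rabs_pos_eq eps) by lra. apply Rmult_le_compat_l; lra. }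
assert (Hexp : forall x B, 0 <= B -> 0 <= x -> B / decay * exp (- decay * K x) <= B / decay).
{ intros x B HB Hx. rewrite <- (Rmult_1_r (B / decay)) at 2.
  apply Rmult_le_compat_l; [now apply Rdiv_le_0_compat|].
  rewrite <- exp_0. apply exp_le_compat. assert (H := K_pos x Hx). nra. }
assert (Hlim : forall u, box u -> is_lim (tail (fun s => eps * src u s)) p_infty 0).
{ intros u Hu. apply (is_lim_tail_exp k K dK K_oo) with decay (eps * A); auto.
  intros x Hx. rewrite Rmult_assoc. auto. }
split; [exact Hlim|split].
- intros u Hu x Hx.
  eapply Rle_trans; [|replace (eps * (A / decay)) with (eps * A / decay) by (unfold Rdiv; ring);
    apply (Hexp x); [now apply Rmult_le_pos; [left|]|exact Hx]].
  apply (lim0_derive_bound k K dK K_oo _ (fun x => - (eps * src u x))); auto.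
  + intros y _. apply (is_derive_tail (fun s => eps * src u s)). auto.
  + intros y Hy. rewrite Rabs_Ropp, Rmult_assoc. auto.
- intros u v d Hu Hv Huv x Hx. assert (Hd := close_pos d u v Huv).
  eapply Rle_trans; [|replace (eps * (C / decay) * d) with (eps * C * d / decay) by (unfold Rdiv; ring);
    apply (Hexp x); [repeat apply Rmult_le_pos; lra|exact Hx]].
  apply (lim0_derive_bound k K dK K_oo
    (fun x => tail (fun s => eps * src u s) x - tail (fun s => eps * src v s) x)
    (fun x => - (eps * src u x) - - (eps * src v x))); auto.
  + intros y _. apply (is_derive_minus (tail (fun s => eps * src u s)) (tail (fun s => eps * src v s)));
      [apply (is_derive_tail (fun s => eps * src u s))|apply (is_derive_tail (fun s => eps * src v s))]; auto.
  + replace (Finite 0) with (Finite (0 - 0)) by (f_equal; ring).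
    apply (is_lim_minus' (tail (fun s => eps * src u s)) (tail (fun s => eps * src v s))); auto.
  + intros y Hy. replace (- (eps * src u y) - - (eps * src v y)) with (- (eps * (src u y - src v y))) by ring.
    rewrite Rabs_Ropp, !Rmult_assoc. apply Habs. rewrite <- Rmult_assoc. auto.
Qed.

(** * Confinement and contraction of the angle *)

(** Since [b <= 1], the function [th + b cos th] is nondecreasing, so only the ends of the interval
    matter. There the barrier gives the lower bound, and at [PI - del] all remaining terms have the
    favourable sign. *)
Lemma angle_source_between (u : component * R -> R) (x : R) : box u -> 0 <= x ->
  del * (k x * exp (- (1) * K x)) <= angle_source u x <= (PI - del) * (k x * exp (- (1) * K x)).
Proof.
intros Hu Hx. destruct (proj2 Hu x) as [H1 [H2 H3]].
unfold angle_source, angle_rhs.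
set (th := u (Angle, x)) in *. set (la := u (Mass, x)) in *. set (ta := u (Lapse, x)) in *.
assert (Hb := b_bd x la H2). assert (Hbar := barrier x la ta Hx H2 H3).
assert (Hq := q_pos x Hx). assert (Hp := p_bd x Hx).
assert (Hpt : 0 <= p x * ta * b x la ^ 2) by (repeat apply Rmult_le_pos; lra || apply pow2_ge_0).
assert (Hcd : 0 <= cos del) by (apply cos_ge_0; generalize PI_RGT_0; lra).
assert (Hmono : forall y z, y <= z -> y + b x la * cos y <= z + b x la * cos z).
{ intros y z Hyz. assert (H := cos_lipschitz z y). rewrite (Rabs_pos_eq (z - y)) in H by lra.
  apply Rabs_le_between in H.
  assert (b x la * (cos z - cos y) >= - (z - y)); [|lra].
  destruct (Rle_dec 0 (cos z - cos y)); nra. }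
assert (Hlo := Hmono del th (proj1 H1)). assert (Hhi := Hmono th (PI - del) (proj2 H1)).
assert (Hpc : cos (PI - del) = - cos del).
{ rewrite cos_minus, cos_PI, sin_PI. ring. }
rewrite Hpc in Hhi.
assert (Hbc : 0 <= b x la * cos del) by (apply Rmult_le_pos; lra).
rewrite (Rmult_comm (exp _)), (Rmult_comm del), (Rmult_comm (PI - del)).
assert (He : 0 <= k x * exp (- (1) * K x)) by (apply Rmult_le_pos; left; [apply k_pos|apply exp_pos]).
split; apply Rmult_le_compat_l; auto; lra.
Qed.

(* [rho] is small enough for the changes of mass and lapse to cost at most half of the gain
   [sin del / 2] from expansion. *)
Lemma angle_source_close (u v : component * R -> R) (d x : R) :
  box u -> box v -> close d u v -> 0 <= x ->
  Rabs (angle_source u x - angle_source v x) <= (1 - decay) * d * (k x * exp (- (1) * K x)).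
Proof.
intros Hu Hv Huv Hx.
destruct (proj2 Hu x) as [H1 [H2 H3]]. destruct (proj2 Hv x) as [H1' [H2' H3']].
assert (Hd := close_pos d u v Huv).
destruct (bounded_close_mult _ _ _ _ _ _ _ _ _ (close_lapse u v d Hu Hv Huv x)
   (bounded_close_pow _ _ _ _ _ 1 (close_b u v d Hu Hv Huv x))) as [_ [_ HA]].
destruct (close_b u v d Hu Hv Huv x) as [_ [_ HB]].
assert (HC := close_angle u v d Huv x).
unfold angle_source, angle_rhs.
set (th := u (Angle, x)) in *. set (la := u (Mass, x)) in *. set (ta := u (Lapse, x)) in *.
set (th' := v (Angle, x)) in *. set (la' := v (Mass, x)) in *. set (ta' := v (Lapse, x)) in *.
assert (HD := add_cos_lipschitz del (b x la) th th' ltac:(lra) (b_bd x la H2) H1 H1').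
set (bu := b x la) in *. set (bv := b x la') in *.
set (e := exp (- (1) * K x)).
replace (e * k x * (th - (p x * ta * bu ^ 2 - bu * cos th + q x))
   - e * k x * (th' - (p x * ta' * bv ^ 2 - bv * cos th' + q x)))
  with (k x * e * ((th + bu * cos th - (th' + bu * cos th')) + ((bu - bv) * cos th'
     + - (p x * (ta * bu ^ 2 - ta' * bv ^ 2))))) by ring.
assert (He : 0 <= k x * e) by (apply Rmult_le_pos; left; [apply k_pos|apply exp_pos]).
rewrite Rabs_mult, (Rabs_pos_eq (k x * e)) by auto.
rewrite Rmult_comm. apply Rmult_le_compat_r; auto.
eapply Rle_trans; [apply Rabs_triang|].
eapply Rle_trans; [apply Rplus_le_compat_l, Rabs_triang|]. rewrite Rabs_Ropp, !Rabs_mult.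
assert (Hs := sin_del_pos).
assert (HE : (1 - sin del / 2) * Rabs (th - th') <= (1 - sin del / 2) * d)
  by (apply Rmult_le_compat_l; lra).
assert (HF : Rabs (bu - bv) * Rabs (cos th') <= 1 / M * rho * d * 1).
{ apply Rmult_le_compat; auto using Rabs_pos. apply Rabs_le, COS_bound. }
assert (HG : Rabs (p x) * Rabs (ta * bu ^ 2 - ta' * bv ^ 2)
   <= 1 * ((2 * (INR 2 * 1 ^ 1 * (1 / M * rho)) + 1 ^ 2 * rho) * d)).
{ apply Rmult_le_compat; auto using Rabs_pos. apply Rabs_le. generalize (p_bd x Hx). lra. }
change (INR 2) with (1 + 1) in HG. rewrite !pow1 in HG.
assert (HH : rho * (1 + 5 / M) = sin del / 4).
{ unfold rho. field. split; lra. }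
replace (5 / M) with (5 * (1 / M)) in HH by (unfold Rdiv; ring).
unfold decay.
assert (HI : d * (rho * (1 + 5 * (1 / M))) = d * (sin del / 4)) by now rewrite HH.
lra.
Qed.

Lemma angle_source_abs (u : component * R -> R) (x : R) : box u -> 0 <= x ->
  Rabs (angle_source u x) <= PI * (k x * exp (- (1) * K x)).
Proof.
intros Hu Hx. assert (H := angle_source_between u x Hu Hx).
assert (He : 0 <= k x * exp (- (1) * K x)) by (apply Rmult_le_pos; left; [apply k_pos|apply exp_pos]).
assert (Hpi := PI_RGT_0).
rewrite Rabs_pos_eq; nra.
Qed.

Lemma is_lim_tail_angle (u : component * R -> R) : box u -> is_lim (tail (angle_source u)) p_infty 0.
Proof.
intro Hu. apply (is_lim_tail_exp k K dK K_oo) with 1 PI; [lra| |].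
- now apply angle_source_cont.
- intros x Hx. now apply angle_source_abs.
Qed.

Lemma exp_K_inv (x a : R) : exp (K x) * (a * exp (- (1) * K x)) = a.
Proof.
replace (- (1) * K x) with (- K x) by ring. rewrite exp_Ropp. field.
generalize (exp_pos (K x)). lra.
Qed.

(** The tail of [a k exp (- K)] is [a exp (- K)], so the pointwise bounds on the source become
    bounds on the new angle after multiplication by [exp K]. *)
Lemma tail_angle_between (u : component * R -> R) (x : R) : box u -> 0 <= x ->
  del <= exp (K x) * tail (angle_source u) x <= PI - del.
Proof.
intros Hu Hx.
assert (Hlim := is_lim_tail_angle u Hu).
(* The sign [s] treats the lower and the upper bound at once. *)
assert (Hmain : forall s a, (forall y, 0 <= y ->
    s * (angle_source u y - a * (k y * exp (- (1) * K y))) >= 0) ->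
  0 <= s * (tail (angle_source u) x - a * exp (- (1) * K x))).
{ intros s a Hs.
  apply (derive_nonpos_lim0_nonneg
    (fun y => s * (tail (angle_source u) y - a * exp (- (1) * K y)))
    (fun y => s * (- angle_source u y - a * (- (1) * k y * exp (- (1) * K y))))); auto.
  - intros y _. apply is_derive_scal.
    apply (is_derive_minus (tail (angle_source u)) (fun y => a * exp (- (1) * K y))).
    + apply is_derive_tail. now apply angle_source_cont.
    + apply is_derive_scal. apply (is_derive_exp_K k K dK).
  - intros y Hy. specialize (Hs y Hy). lra.
  - replace (Finite 0) with (Finite (s * (0 - a * 0))) by (f_equal; ring).
    apply (is_lim_scal_l _ s p_infty (0 - a * 0)).
    apply (is_lim_minus' (tail (angle_source u)) (fun y => a * exp (- (1) * K y))); auto.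
    apply (is_lim_scal_l _ a p_infty 0). apply (is_lim_exp_K K K_oo). lra. }
assert (HE := exp_pos (K x)).
assert (H1 := Hmain 1 del). assert (H2 := Hmain (-1) (PI - del)).
rewrite <- (exp_K_inv x del) at 1. rewrite <- (exp_K_inv x (PI - del)).
split; apply Rmult_le_compat_l; try lra.
- enough (0 <= 1 * (tail (angle_source u) x - del * exp (- (1) * K x))) by lra.
  apply H1. intros y Hy. generalize (angle_source_between u y Hu Hy). lra.
- enough (0 <= -1 * (tail (angle_source u) x - (PI - del) * exp (- (1) * K x))) by lra.
  apply H2. intros y Hy. generalize (angle_source_between u y Hu Hy). lra.
Qed.

(** The bound on the difference of the sources integrates exactly to [(1 - decay) * d * exp (- K)],
    which [exp K] cancels. This contraction holds without smallness of [eps]. *)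
Lemma tail_angle_close (u v : component * R -> R) (d x : R) :
  box u -> box v -> close d u v -> 0 <= x ->
  Rabs (exp (K x) * tail (angle_source u) x - exp (K x) * tail (angle_source v) x) <= (1 - decay) * d.
Proof.
intros Hu Hv Huv Hx.
rewrite <- Rmult_minus_distr_l, Rabs_mult, (Rabs_pos_eq (exp (K x))) by (left; apply exp_pos).
rewrite <- (exp_K_inv x ((1 - decay) * d)).
apply Rmult_le_compat_l; [left; apply exp_pos|].
assert (H := lim0_derive_bound k K dK K_oo
  (fun y => tail (angle_source u) y - tail (angle_source v) y)
  (fun y => - angle_source u y - - angle_source v y) 1 ((1 - decay) * d) Rlt_0_1).
replace ((1 - decay) * d / 1) with ((1 - decay) * d) in H by field.
apply H; auto.
- intros y _. apply (is_derive_minus (tail (angle_source u)) (tail (angle_source v)));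
    apply is_derive_tail; now apply angle_source_cont.
- replace (Finite 0) with (Finite (0 - 0)) by (f_equal; ring).
  apply (is_lim_minus' (tail (angle_source u)) (tail (angle_source v))); now apply is_lim_tail_angle.
- intros y Hy.
  replace (- angle_source u y - - angle_source v y) with (- (angle_source u y - angle_source v y)) by ring.
  rewrite Rabs_Ropp. now apply angle_source_close.
Qed.

(** * Existence of the fixed point *)

Lemma is_derive_tail_eps (eps : R) (f : R -> R) (x : R) :
  (forall y, continuous f y) -> is_derive (tail (fun s => eps * f s)) x (- (eps * f x)).
Proof.
intro Hf. apply (is_derive_tail (fun s => eps * f s)). intro y.
apply (continuous_Rmult (fun _ => eps)); [apply continuous_const|auto].
Qed.

Lemma integral_map_cont (eps : R) (u : component * R -> R) (c : component) (x : R) :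
  box u -> continuous (fun y => integral_map eps u (c, y)) x.
Proof.
intro Hu.
assert (HK := K_cont).
assert (Ht : forall f, (forall y, continuous f y) -> forall y, continuous (tail f) y).
{ intros f Hf y. apply (is_derive_continuousR _ _ _ (is_derive_tail f y Hf)). }
assert (Ht' : forall f, (forall y, continuous f y) -> forall y, continuous (tail (fun s => eps * f s)) y).
{ intros f Hf y. apply (is_derive_continuousR _ _ _ (is_derive_tail_eps eps f y Hf)). }
destruct c.
- apply (continuous_Rmax0 (fun y => exp (K y) * tail (angle_source u) y)).
  intro y. assert (H := Ht _ (angle_source_cont u Hu)). cont.
- apply (continuous_Rmax0 (fun y => M + tail (fun s => eps * mass_source u s) y)).
  intro y. assert (H := Ht' _ (mass_source_cont u Hu)). cont.
- apply (continuous_Rmax0 (fun y => 1 - tail (fun s => eps * lapse_source u s) y)).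
  intro y. assert (H := Ht' _ (lapse_source_cont u Hu)). cont.
Qed.

Lemma mass_source_nonneg (u : component * R -> R) (x : R) : box u -> 0 <= x -> 0 <= mass_source u x.
Proof.
intros Hu Hx. unfold mass_source, mass_rhs.
apply Rmult_le_pos; [left; apply k_pos|]. apply Rmult_le_pos; [left; apply exp_pos|].
apply Rmult_le_pos; [|apply pow2_ge_0]. apply Rmult_le_pos; [|apply pow2_ge_0]. now apply p_bd.
Qed.

(** Keeps [la >= M] in the box: the density makes [la] grow towards the centre. *)
Lemma tail_mass_nonneg (eps : R) (u : component * R -> R) (x : R) :
  0 < eps -> box u -> 0 <= x -> 0 <= tail (fun s => eps * mass_source u s) x.
Proof.
intros He Hu Hx. destruct mass_source_small as [A [C H]].
apply (derive_nonpos_lim0_nonneg _ (fun y => - (eps * mass_source u y))); auto.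
- intros y _. apply is_derive_tail_eps. now apply mass_source_cont.
- intros y Hy. generalize (Rmult_le_pos _ _ (Rlt_le _ _ He) (mass_source_nonneg u y Hu Hy)). lra.
- now apply (tail_small mass_source A C eps H He).
Qed.

Lemma box_closed (un : nat -> component * R -> R) (v : component * R -> R) :
  (forall n, box (un n)) ->
  (forall e, 0 < e -> exists n, forall cx, Rabs (un n cx - v cx) <= e * weight cx) -> box v.
Proof.
intros Hun Hlim.
assert (Hr := rho_pos).
assert (Hlim' : forall e, 0 < e -> exists n, forall cx, Rabs (un n cx - v cx) <= e).
{ intros e He. destruct (Hlim (e / (1 + rho))) as [n Hn]; [apply Rdiv_lt_0_compat; lra|].
  exists n. intro cx. eapply Rle_trans; [apply Hn|].
  apply Rle_trans with (e / (1 + rho) * (1 + rho)); [|right; field; lra].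
  apply Rmult_le_compat_l; [apply Rdiv_le_0_compat; lra|].
  unfold weight. destruct (fst cx); lra. }
split.
- intros c. apply continuous_uniform_limit. intros e He.
  destruct (Hlim' e He) as [n Hn]. exists (fun y => un n (c, y)). split.
  + apply (proj1 (Hun n)).
  + intro x. apply Hn.
- intro x.
  repeat split; apply le_of_approx; intros e He; destruct (Hlim' e He) as [n Hn];
    destruct (proj2 (Hun n) x) as [H1 [H2 H3]].
  1,2: generalize (Hn (Angle, x)); intro H; apply Rabs_le_between in H; lra.
  1,2: generalize (Hn (Mass, x)); intro H; apply Rabs_le_between in H; lra.
  1,2: generalize (Hn (Lapse, x)); intro H; apply Rabs_le_between in H; lra.
Qed.

Lemma integral_map_fixed_point : exists eps u, 0 < eps /\ box u /\
  forall cx, integral_map eps u cx = u cx.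
Proof.
destruct mass_source_small as [A [C Hm]]. destruct lapse_source_small as [A' [C' Hl]].
assert (Hc := decay_pos). assert (Hr := rho_pos). assert (Hs := sin_del_pos).
assert (Hpi := PI_RGT_0).
set (D := A / decay + C / decay + A' / decay + C' / decay + 1).
assert (HA : 0 <= A / decay) by (apply Rdiv_le_0_compat; [apply Hm|auto]).
assert (HC : 0 <= C / decay) by (apply Rdiv_le_0_compat; [apply Hm|auto]).
assert (HA' : 0 <= A' / decay) by (apply Rdiv_le_0_compat; [apply Hl|auto]).
assert (HC' : 0 <= C' / decay) by (apply Rdiv_le_0_compat; [apply Hl|auto]).
assert (HD : 0 < D) by (unfold D; lra).
(* The bound [M] keeps the mass below [2 * M], [eta] keeps the lapse in its range, and [rho / 2]
   makes these two components contract by [1 / 2 <= 1 - decay]. *)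
set (mn := Rmin (Rmin M eta) (rho / 2)).
assert (Hmn : 0 < mn) by (unfold mn; repeat apply Rmin_glb_lt; lra).
assert (Hmn1 : mn <= M) by (unfold mn; eapply Rle_trans; [apply Rmin_l|apply Rmin_l]).
assert (Hmn2 : mn <= eta) by (unfold mn; eapply Rle_trans; [apply Rmin_l|apply Rmin_r]).
assert (Hmn3 : mn <= rho / 2) by (unfold mn; apply Rmin_r).
set (eps := mn / D).
assert (Heps : 0 < eps) by (unfold eps; apply Rdiv_lt_0_compat; auto).
assert (HepsD : eps * D = mn) by (unfold eps; field; lra).
assert (Hle : forall z, z <= D -> eps * z <= mn).
{ intros z Hz. rewrite <- HepsD. apply Rmult_le_compat_l; lra. }
assert (HeA := Hle (A / decay) ltac:(unfold D; lra)).
assert (HeC := Hle (C / decay) ltac:(unfold D; lra)).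
assert (HeA' := Hle (A' / decay) ltac:(unfold D; lra)).
assert (HeC' := Hle (C' / decay) ltac:(unfold D; lra)).
destruct (tail_small mass_source A C eps Hm Heps) as [_ [Hm1 Hm2]].
destruct (tail_small lapse_source A' C' eps Hl Heps) as [_ [Hl1 Hl2]].
assert (Hx0 : forall x, 0 <= Rmax 0 x) by (intro; apply Rmax_l).
assert (Hbox : forall u, box u -> box (integral_map eps u)).
{ intros u Hu. split.
  - intros c x. now apply integral_map_cont.
  - intro x. unfold integral_map; simpl. specialize (Hx0 x).
    generalize (tail_angle_between u _ Hu Hx0) (Hm1 u Hu _ Hx0) (Hl1 u Hu _ Hx0)
      (tail_mass_nonneg eps u _ Heps Hu Hx0).
    intros H1 H2 H3 H4. apply Rabs_le_between in H2. apply Rabs_le_between in H3. lra. }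
set (u0 := fun cx : component * R => match fst cx with Angle => PI / 2 | Mass => M | Lapse => 1 end).
assert (Hu0 : box u0).
{ split.
  - intros c x. unfold u0; simpl. apply continuous_const.
  - intro x. unfold u0; simpl. lra. }
(* The first distance is bounded by the size of the box: [PI] for the angle, and a numerator divided
   by [rho] to undo the weight of mass and lapse. *)
destruct (banach_fixed_point (component * R) weight box (integral_map eps) (1 - decay)
   ((PI + M + 2 * eta) / rho + PI) u0) as [u [Hu Hfix]].
- unfold decay in *. lra.
- intro cx. unfold weight. destruct (fst cx); lra.
- assert (0 <= (PI + M + 2 * eta) / rho) by (apply Rdiv_le_0_compat; lra). lra.
- exact Hbox.
- intros u v d Hu Hv Hd Huv [c x].
  assert (Hq : 1 / 2 <= 1 - decay) by (unfold decay; lra).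
  assert (Hd2 : 0 <= d * rho) by (apply Rmult_le_pos; lra).
  destruct c; unfold weight, integral_map; simpl.
  + rewrite Rmult_1_r. now apply tail_angle_close.
  + match goal with |- Rabs (M + ?a - (M + ?b)) <= _ => replace (M + a - (M + b)) with (a - b) by ring end.
    eapply Rle_trans; [apply (Hm2 u v d Hu Hv Huv), Hx0|].
    apply Rle_trans with (rho / 2 * d); [apply Rmult_le_compat_r; lra|]. nra.
  + match goal with |- Rabs (1 - ?a - (1 - ?b)) <= _ => replace (1 - a - (1 - b)) with (- (a - b)) by ring end.
    rewrite Rabs_Ropp.
    eapply Rle_trans; [apply (Hl2 u v d Hu Hv Huv), Hx0|].
    apply Rle_trans with (rho / 2 * d); [apply Rmult_le_compat_r; lra|]. nra.
- exact Hu0.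
- intros [c x].
  destruct (proj2 Hu0 x) as [H1 [H2 H3]]. destruct (proj2 (Hbox u0 Hu0) x) as [H1' [H2' H3']].
  assert (H4 : 0 <= (PI + M + 2 * eta) / rho) by (apply Rdiv_le_0_compat; lra).
  assert (H5 : ((PI + M + 2 * eta) / rho + PI) * rho = PI + M + 2 * eta + PI * rho) by (field; lra).
  assert (H6 : 0 <= PI * rho) by (apply Rmult_le_pos; lra).
  destruct c; unfold weight; simpl fst; cbv iota; apply Rabs_le; lra.
- exact box_closed.
- exists eps, u. auto.
Qed.

Lemma reduced_system_solution : exists (eps : R) (th L la ta : R -> R),
  0 < eps /\
  (forall x, M <= la x <= 2 * M /\ 1 - eta <= ta x <= 1 + eta) /\
  (forall x, 0 < x -> is_derive th x (k x * angle_rhs x (th x) (la x) (ta x))) /\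
  (forall x, 0 < x -> is_derive L x (- (k x * (b x (la x) * sin (th x))))) /\
  (forall x, 0 < x -> is_derive la x (- (eps * (k x * (exp (L x) * mass_rhs x (la x) (ta x)))))) /\
  (forall x, 0 < x ->
     is_derive ta x (eps * (k x * (exp (L x) * lapse_rhs x (th x) (la x) (ta x))))) /\
  is_lim la p_infty M /\ is_lim ta p_infty 1.
Proof.
destruct integral_map_fixed_point as [eps [u [Heps [Hu Hfix]]]].
(* At [x > 0] the clamp is inactive in a neighbourhood, so each component inherits the derivative of
   its unclamped formula [Q]. *)
assert (Hloc : forall c (Q : R -> R), (forall y, integral_map eps u (c, y) = Q (Rmax 0 y)) ->
  (forall x, 0 < x -> u (c, x) = Q x) /\
  (forall x l, 0 < x -> is_derive Q x l -> is_derive (fun y => u (c, y)) x l)).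
{ intros c Q HQ.
  assert (H : forall x, 0 < x -> u (c, x) = Q x).
  { intros x Hx. rewrite <- Hfix, HQ, Rmax_right; auto. lra. }
  split; auto. intros x l Hx Hd. apply (is_derive_ext_loc Q); auto.
  assert (Hx2 : 0 < x / 2) by lra.
  exists (mkposreal _ Hx2). intros y Hy. change (Rabs (y - x) < x / 2) in Hy.
  apply Rabs_def2 in Hy. symmetry. apply H. lra. }
assert (Hlim : forall c (Q : R -> R) (l : R), (forall x, 0 < x -> u (c, x) = Q x) ->
  is_lim Q p_infty l -> is_lim (fun y => u (c, y)) p_infty l).
{ intros c Q l HQ. apply is_lim_ext_loc. exists 0. intros y Hy. symmetry. auto. }
destruct (Hloc Angle (fun x => exp (K x) * tail (angle_source u) x)) as [Ha Ha']; [reflexivity|].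
destruct (Hloc Mass (fun x => M + tail (fun s => eps * mass_source u s) x)) as [Hm Hm']; [reflexivity|].
destruct (Hloc Lapse (fun x => 1 - tail (fun s => eps * lapse_source u s) x)) as [Hl Hl']; [reflexivity|].
exists eps, (fun x => u (Angle, x)), (log_density u), (fun x => u (Mass, x)), (fun x => u (Lapse, x)).
split; [exact Heps|]. split; [exact (fun x => proj2 (proj2 Hu x))|].
split; [|split; [|split; [|split; [|split]]]].
- intros x Hx. apply Ha'; auto.
  evar_last.
  + apply (is_derive_mult (fun y => exp (K y)) (tail (angle_source u))).
    * apply (is_derive_comp exp K); [apply is_derive_exp|apply dK].
    * apply is_derive_tail. now apply angle_source_cont.
    * intros; apply Rmult_comm.
  + unfold plus, mult, scal; simpl. unfold mult; simpl.
    assert (H := Ha x Hx). unfold angle_source at 2.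
    assert (HE := exp_K_inv x 1). rewrite Rmult_1_l in HE.
    set (r := angle_rhs x (u (Angle, x)) (u (Mass, x)) (u (Lapse, x))).
    replace (exp (K x) * - (exp (- (1) * K x) * k x * (u (Angle, x) - r))) with
      (- (exp (K x) * exp (- (1) * K x) * k x * (u (Angle, x) - r))) by ring.
    rewrite HE.
    replace (k x * exp (K x) * tail (angle_source u) x) with
      (k x * (exp (K x) * tail (angle_source u) x)) by ring.
    rewrite <- H. ring.
- intros x Hx. now apply is_derive_log_density.
- intros x Hx. apply Hm'; auto.
  evar_last.
  + apply (is_derive_plus (fun _ => M) (tail (fun s => eps * mass_source u s))).
    * exact (is_derive_const (V := R_NormedModule) M x).
    * apply is_derive_tail_eps. now apply mass_source_cont.
  + unfold mass_source. exact (Rplus_0_l _).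
- intros x Hx. apply Hl'; auto.
  evar_last.
  + apply (is_derive_minus (fun _ => 1) (tail (fun s => eps * lapse_source u s))).
    * exact (is_derive_const (V := R_NormedModule) 1 x).
    * apply is_derive_tail_eps. now apply lapse_source_cont.
  + change (0 - - (eps * lapse_source u x) = eps * lapse_source u x). ring.
- apply (Hlim Mass _ M Hm). destruct mass_source_small as [A [C H]].
  replace (Finite M) with (Finite (M + 0)) by (f_equal; ring).
  apply (is_lim_plus' (fun _ => M) (tail (fun s => eps * mass_source u s))); [apply is_lim_const|].
  now apply (tail_small mass_source A C eps H Heps).
- apply (Hlim Lapse _ 1 Hl). destruct lapse_source_small as [A [C H]].
  replace (Finite 1) with (Finite (1 - 0)) by (f_equal; ring).
  apply (is_lim_minus' (fun _ => 1) (tail (fun s => eps * lapse_source u s))); [apply is_lim_const|].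
  now apply (tail_small lapse_source A C eps H Heps).
Qed.

End FixedPoint.

(** * The coefficients of the reduced system *)

(** With [x^2 = m r] this is [sqrt (1 + (m r)^2)], the amplitude of [m r cos TH + sin TH]. *)
Definition S4 (x : R) : R := sqrt (1 + x ^ 4).
(** Frozen at the limiting mass [M], so that [K] and the weights [exp (- c * K)] are common to all
    states; the dependence on [la] is left to [metric_ratio]. *)
Definition rate (M x : R) : R := 4 * S4 x / sqrt (x ^ 2 + M).
(** The background value of [sqrt A] over the actual one, as [A = (x^2 + la) / x^2]. *)
Definition metric_ratio (M x la : R) : R := sqrt ((x ^ 2 + M) / (x ^ 2 + la)).
Definition lapse_coeff (M w x : R) : R := w * x ^ 3 / (sqrt (x ^ 2 + M) * S4 x).
(** The derivative [2 x / (1 + x^4)] of [- atan (1 / x^2)] divided by [rate]: the effect of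
    measuring the angle from a moving direction. *)
Definition drift_coeff (M x : R) : R := x * sqrt (x ^ 2 + M) / (2 * (1 + x ^ 4) * S4 x).

Lemma one_plus_pow4_ge (x : R) : 1 <= 1 + x ^ 4.
Proof. replace (x ^ 4) with ((x ^ 2) ^ 2) by ring. generalize (pow2_ge_0 (x ^ 2)). lra. Qed.

Lemma S4_sqr (x : R) : S4 x * S4 x = 1 + x ^ 4.
Proof. apply sqrt_sqrt. generalize (one_plus_pow4_ge x). lra. Qed.

Lemma S4_ge_1 (x : R) : 1 <= S4 x.
Proof. rewrite <- sqrt_1. apply sqrt_le_1_alt, one_plus_pow4_ge. Qed.

Lemma S4_ge_sqr (x : R) : x ^ 2 <= S4 x.
Proof.
assert (H := pow2_ge_0 x). rewrite <- (sqrt_pow2 (x ^ 2)) by auto.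
apply sqrt_le_1_alt. replace ((x ^ 2) ^ 2) with (x ^ 4) by ring. lra.
Qed.

Lemma S4_ge_id (x : R) : x <= S4 x.
Proof. generalize (S4_ge_1 x) (S4_ge_sqr x). intros. destruct (Rle_dec x 1); nra. Qed.

Lemma S4_cont (x : R) : continuous S4 x.
Proof. apply (continuous_compR (fun y => 1 + y ^ 4) sqrt); [cont|apply continuous_sqrt]. Qed.

Section Coefficients.

Context (M eta w : R) (eta_bd : 0 < eta <= 1 / 2) (M_def : M = eta ^ 2 / 8).
Context (w_def : w = 1 - 2 * eta).

Let M_pos : 0 < M.
Proof. subst M. nra. Qed.

Let sum_pos (x la : R) : M <= la -> 0 < x ^ 2 + la.
Proof. generalize (pow2_ge_0 x). lra. Qed.

Let sqrt_sum_pos (x la : R) : M <= la -> 0 < sqrt (x ^ 2 + la).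
Proof. intro H. apply sqrt_lt_R0. auto. Qed.

Let sqrt_sum_sqr (x la : R) : M <= la -> sqrt (x ^ 2 + la) * sqrt (x ^ 2 + la) = x ^ 2 + la.
Proof. intro H. apply sqrt_sqrt. left. auto. Qed.

Lemma sqrt_sum_ge (x la : R) : 0 <= x -> M <= la -> x <= sqrt (x ^ 2 + la).
Proof.
intros Hx H. rewrite <- (sqrt_pow2 x) at 1 by auto. apply sqrt_le_1_alt. lra.
Qed.

Lemma metric_ratio_eq (x la : R) : M <= la ->
  metric_ratio M x la = sqrt (x ^ 2 + M) / sqrt (x ^ 2 + la).
Proof. intro H. apply sqrt_div_alt. auto. Qed.

Lemma metric_ratio_sqr (x la : R) : M <= la ->
  metric_ratio M x la ^ 2 = (x ^ 2 + M) / (x ^ 2 + la).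
Proof.
intro H. apply pow2_sqrt. apply Rdiv_le_0_compat; auto. left. apply sum_pos; lra.
Qed.

Lemma metric_ratio_bounds (x la : R) : M <= la <= 2 * M -> 1 / 2 <= metric_ratio M x la <= 1.
Proof.
intro H. assert (Hx := pow2_ge_0 x). assert (H1 := sum_pos x la (proj1 H)).
assert (H2 := metric_ratio_sqr x la (proj1 H)).
assert (H3 : 0 <= metric_ratio M x la) by apply sqrt_pos.
assert (H4 : (x ^ 2 + M) / (x ^ 2 + la) <= 1).
{ apply Rmult_le_reg_r with (x ^ 2 + la); auto. unfold Rdiv. rewrite Rmult_assoc, Rinv_l; lra. }
assert (H5 : 1 / 4 <= (x ^ 2 + M) / (x ^ 2 + la)).
{ apply Rmult_le_reg_r with (x ^ 2 + la); auto.
  replace ((x ^ 2 + M) / (x ^ 2 + la) * (x ^ 2 + la)) with (x ^ 2 + M) by (field; lra). lra. }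
split; nra.
Qed.

(** The squares are rational in the mass, and their difference controls that of the roots because
    both roots are at least [1 / 2], so their sum is at least [1]. *)
Lemma metric_ratio_lipschitz (x la la' : R) : M <= la <= 2 * M -> M <= la' <= 2 * M ->
  Rabs (metric_ratio M x la - metric_ratio M x la') <= 1 / M * Rabs (la - la').
Proof.
intros H H'. assert (Hx := pow2_ge_0 x).
assert (H1 := sum_pos x la (proj1 H)). assert (H1' := sum_pos x la' (proj1 H')).
assert (H2 := metric_ratio_sqr x la (proj1 H)). assert (H2' := metric_ratio_sqr x la' (proj1 H')).
assert (H3 := metric_ratio_bounds x la H). assert (H3' := metric_ratio_bounds x la' H').
set (a := metric_ratio M x la) in *. set (a' := metric_ratio M x la') in *.
assert (HE : (a - a') * (a + a') = a ^ 2 * (la' - la) / (x ^ 2 + la')).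
{ replace ((a - a') * (a + a')) with (a ^ 2 - a' ^ 2) by ring. rewrite H2, H2'. field. lra. }
assert (HA : Rabs ((a - a') * (a + a')) <= 1 / M * Rabs (la - la')).
{ rewrite HE. unfold Rdiv at 1. rewrite !Rabs_mult, Rmult_comm, (Rabs_minus_sym la').
  rewrite <- Rmult_assoc. apply Rmult_le_compat_r; [apply Rabs_pos|].
  rewrite <- (Rmult_1_r (1 / M)).
  apply Rmult_le_compat; try apply Rabs_pos.
  - rewrite Rabs_pos_eq by (left; apply Rinv_0_lt_compat; auto).
    unfold Rdiv. rewrite Rmult_1_l. apply Rinv_le_contravar; lra.
  - rewrite Rabs_pos_eq; nra. }
eapply Rle_trans; [|apply HA]. rewrite Rabs_mult.
rewrite <- (Rmult_1_r (Rabs (a - a'))) at 1.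
apply Rmult_le_compat_l; [apply Rabs_pos|]. rewrite Rabs_pos_eq; lra.
Qed.

Lemma metric_ratio_cont (la : R -> R) :
  (forall x, continuous la x) -> (forall x, M <= la x) ->
  forall x, continuous (fun y => metric_ratio M y (la y)) x.
Proof.
intros Hla Hge x. unfold metric_ratio.
apply (continuous_compR (fun y => (y ^ 2 + M) / (y ^ 2 + la y)) sqrt); [|apply continuous_sqrt].
apply (continuous_Rmult (fun y => y ^ 2 + M) (fun y => / (y ^ 2 + la y))).
- cont.
- apply continuous_Rinv_comp; [cont|]. generalize (sum_pos x (la x) (Hge x)). lra.
Qed.

Lemma sqrt_sum_cont (x : R) : continuous (fun y => sqrt (y ^ 2 + M)) x.
Proof. apply (continuous_compR (fun y => y ^ 2 + M) sqrt); [cont|apply continuous_sqrt]. Qed.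

Lemma rate_cont (x : R) : continuous (rate M) x.
Proof.
apply (continuous_Rmult (fun y => 4 * S4 y) (fun y => / sqrt (y ^ 2 + M))).
- assert (H := S4_cont). cont.
- apply continuous_Rinv_comp; [apply sqrt_sum_cont|].
  generalize (sqrt_sum_pos x M (Rle_refl M)). lra.
Qed.

(** Gives [K x >= x] for [x >= 0], hence [K] tends to infinity. *)
Lemma rate_ge_1 (x : R) : 1 <= rate M x.
Proof.
assert (H'' := sqrt_sum_pos x M (Rle_refl M)).
assert (H : sqrt (x ^ 2 + M) <= 4 * S4 x).
{ assert (H4 := S4_sqr x). assert (H1 := S4_ge_1 x). assert (H3 := S4_ge_sqr x).
  assert (H5 := sqrt_sum_sqr x M (Rle_refl M)).
  assert (M <= 1) by (subst M; nra).
  apply Rsqr_incr_0_var; [|lra]. unfold Rsqr. rewrite H5. nra. }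
unfold rate. apply Rmult_le_reg_r with (sqrt (x ^ 2 + M)); auto.
unfold Rdiv. rewrite Rmult_assoc, Rinv_l; lra.
Qed.

Lemma lapse_coeff_cont (x : R) : continuous (lapse_coeff M w) x.
Proof.
apply (continuous_Rmult (fun y => w * y ^ 3) (fun y => / (sqrt (y ^ 2 + M) * S4 y))); [cont|].
assert (H := S4_cont). assert (H' := sqrt_sum_cont).
apply continuous_Rinv_comp; [cont|].
generalize (Rmult_lt_0_compat _ _ (sqrt_sum_pos x M (Rle_refl M)) (Rlt_le_trans _ _ _ Rlt_0_1 (S4_ge_1 x))).
lra.
Qed.

Lemma lapse_coeff_bounds (x : R) : 0 <= x -> 0 <= lapse_coeff M w x <= 1.
Proof.
intro Hx. assert (H1 := S4_ge_1 x). assert (H2 := S4_ge_sqr x).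
assert (H3 := sqrt_sum_ge x M Hx (Rle_refl M)). assert (H4 := sqrt_sum_pos x M (Rle_refl M)).
assert (H5 : 0 < sqrt (x ^ 2 + M) * S4 x) by (apply Rmult_lt_0_compat; lra).
assert (H6 : 0 <= x ^ 3) by now apply pow_le.
assert (H7 : x ^ 3 <= sqrt (x ^ 2 + M) * S4 x).
{ replace (x ^ 3) with (x * x ^ 2) by ring. apply Rmult_le_compat; auto. apply pow2_ge_0. }
unfold lapse_coeff. split.
- apply Rdiv_le_0_compat; auto. apply Rmult_le_pos; lra.
- apply Rmult_le_reg_r with (sqrt (x ^ 2 + M) * S4 x); auto.
  unfold Rdiv. rewrite Rmult_assoc, Rinv_l by lra. nra.
Qed.

Lemma drift_coeff_cont (x : R) : continuous (drift_coeff M) x.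
Proof.
assert (H := S4_cont). assert (H' := sqrt_sum_cont).
apply (continuous_Rmult (fun y => y * sqrt (y ^ 2 + M)) (fun y => / (2 * (1 + y ^ 4) * S4 y))); [cont|].
apply continuous_Rinv_comp; [cont|].
assert (H1 := one_plus_pow4_ge x). assert (H2 := S4_ge_1 x). nra.
Qed.

Lemma drift_coeff_nonneg (x : R) : 0 <= x -> 0 <= drift_coeff M x.
Proof.
intro Hx. assert (H1 := S4_ge_1 x). assert (H := one_plus_pow4_ge x).
assert (H4 := sqrt_sum_pos x M (Rle_refl M)).
apply Rdiv_le_0_compat; [apply Rmult_le_pos; lra|]. apply Rmult_lt_0_compat; lra.
Qed.

(* With [s = x^2 / sqrt (1 + x^4)] in [[0, 1]], the left-hand side divided by [metric_ratio] is at
   most [(1 - eta) s + s (1 - s^2) / 2 + eta / 4], and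
   [1 - s - s (1 - s^2) / 2 = (1 - s)^2 (2 + s) / 2]. *)
Lemma angle_barrier (x la ta : R) :
  0 <= x -> M <= la <= 2 * M -> 1 - eta <= ta <= 1 + eta ->
  lapse_coeff M w x * ta * metric_ratio M x la ^ 2
   - metric_ratio M x la * (1 - eta / 2) + drift_coeff M x <= 0.
Proof.
intros Hx Hla Hta.
assert (Hb := metric_ratio_bounds x la Hla).
assert (HbE := metric_ratio_eq x la (proj1 Hla)).
assert (H1 := S4_ge_1 x). assert (H2 := S4_ge_sqr x). assert (H2' := S4_ge_id x).
assert (H4 := S4_sqr x). assert (H5 := one_plus_pow4_ge x).
assert (HB0 := sqrt_sum_pos x M (Rle_refl M)). assert (HB := sqrt_sum_pos x la (proj1 Hla)).
assert (HBx := sqrt_sum_ge x la Hx (proj1 Hla)).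
assert (HBu : sqrt (x ^ 2 + la) <= x + eta / 2).
{ apply Rsqr_incr_0_var; [|lra]. unfold Rsqr. rewrite sqrt_sum_sqr by lra.
  assert (2 * M = (eta / 2) * (eta / 2)) by (subst M; field). nra. }
set (B0 := sqrt (x ^ 2 + M)) in *. set (B := sqrt (x ^ 2 + la)) in *.
set (b := metric_ratio M x la) in *. set (s := S4 x) in *.
assert (Hp : lapse_coeff M w x * b = w * (x / B) * (x ^ 2 / s)).
{ unfold lapse_coeff. fold B0 s. rewrite HbE. field. lra. }
assert (Hq : drift_coeff M x = b * (x * B / (2 * s ^ 3))).
{ unfold drift_coeff. fold B0 s. rewrite HbE, <- H4. field. lra. }
set (sg := x ^ 2 / s).
assert (Hsg : 0 <= sg <= 1).
{ unfold sg. split.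
  - apply Rdiv_le_0_compat; [apply pow2_ge_0|lra].
  - apply Rmult_le_reg_r with s; [lra|]. unfold Rdiv. rewrite Rmult_assoc, Rinv_l; lra. }
assert (HxB : 0 <= x / B <= 1).
{ split; [apply Rdiv_le_0_compat; lra|].
  apply Rmult_le_reg_r with B; [lra|]. unfold Rdiv. rewrite Rmult_assoc, Rinv_l; lra. }
assert (Hfirst : ta * (lapse_coeff M w x * b) <= (1 - eta) * sg).
{ rewrite Hp. fold sg.
  assert (0 <= w) by lra.
  assert (Hwt : ta * w <= 1 - eta) by nra.
  replace (ta * (w * (x / B) * sg)) with (ta * w * (x / B) * sg) by ring.
  apply Rmult_le_compat_r; [lra|].
  assert (0 <= ta * w) by (apply Rmult_le_pos; lra). nra. }
assert (Hs3 : 0 < s ^ 3) by (apply pow_lt; lra).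
assert (Hinv : / s ^ 2 = 1 - sg ^ 2).
{ unfold sg. assert (s ^ 2 = 1 + x ^ 4) by (simpl; lra).
  replace ((x ^ 2 / s) ^ 2) with (x ^ 4 / s ^ 2) by (field; lra). rewrite H. field. lra. }
assert (Hxs : x / s ^ 3 <= 1).
{ apply Rmult_le_reg_r with (s ^ 3); auto. unfold Rdiv. rewrite Rmult_assoc, Rinv_l by lra.
  assert (1 <= s * s) by nra. replace (s ^ 3) with (s * (s * s)) by ring. nra. }
assert (Hsecond : x * B / (2 * s ^ 3) <= sg * (1 - sg ^ 2) / 2 + eta / 4).
{ apply Rle_trans with (x * (x + eta / 2) / (2 * s ^ 3)).
  - apply Rmult_le_compat_r; [left; apply Rinv_0_lt_compat; lra|]. apply Rmult_le_compat_l; lra.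
  - replace (x * (x + eta / 2) / (2 * s ^ 3)) with (x ^ 2 / s * / s ^ 2 / 2 + eta / 4 * (x / s ^ 3))
      by (field; lra).
    rewrite Hinv. fold sg. nra. }
assert (Hpoly : (1 - eta) * sg + (sg * (1 - sg ^ 2) / 2 + eta / 4) <= 1 - eta / 2).
(* With [t = 1 - sg] the difference of the two sides is [t^2 sg / 2 + t^2 - eta t + eta / 4], and
   the last three terms are [(t - eta / 2)^2 + eta (1 - eta) / 4]. *)
{ assert (0 <= (1 - sg) ^ 2 * sg) by (apply Rmult_le_pos; [apply pow2_ge_0|lra]).
  assert (0 <= (1 - sg - eta / 2) ^ 2) by apply pow2_ge_0.
  nra. }
rewrite Hq.
replace (lapse_coeff M w x * ta * b ^ 2) with (b * (ta * (lapse_coeff M w x * b))) by ring.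
nra.
Qed.

End Coefficients.

Lemma unit_mass_solution (w : R) : 0 < w < 1 -> exists (eps M : R) (th L la ta : R -> R),
  0 < eps /\
  (forall x, 0 < la x /\ 0 < ta x) /\
  (forall x, 0 < x -> is_derive th x
     (4 * w * ta x * x ^ 3 / sqrt (x ^ 2 + la x) ^ 2
      - 4 * S4 x * cos (th x) / sqrt (x ^ 2 + la x) + 2 * x / (1 + x ^ 4))) /\
  (forall x, 0 < x -> is_derive L x (- (4 * S4 x * sin (th x) / sqrt (x ^ 2 + la x)))) /\
  (forall x, 0 < x -> is_derive la x
     (- (4 * eps * w * ta x ^ 2 * x ^ 3 * exp (L x) / sqrt (x ^ 2 + la x) ^ 2))) /\
  (forall x, 0 < x -> is_derive ta x
     (eps * exp (L x) * (2 * S4 x * ta x ^ 2 * cos (th x) / sqrt (x ^ 2 + la x) ^ 3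
        - 4 * w * ta x ^ 3 * x ^ 3 / sqrt (x ^ 2 + la x) ^ 4))) /\
  is_lim la p_infty M /\ is_lim ta p_infty 1.
Proof.
intro Hw.
(* The choice of [eta] gives [w (1 + eta) <= 1 - eta], and [2 M = (eta / 2)^2] gives
   [sqrt (x^2 + la) <= x + eta / 2] in the box. With these, the barrier holds for
   [cos del = 1 - eta / 2]. *)
set (eta := (1 - w) / 2). set (M := eta ^ 2 / 8). set (del := acos (1 - eta / 2)).
assert (Heta : 0 < eta <= 1 / 2) by (unfold eta; lra).
assert (HM : M = eta ^ 2 / 8) by reflexivity.
assert (Hwe : w = 1 - 2 * eta) by (unfold eta; field).
assert (HMpos : 0 < M) by (rewrite HM; nra).
assert (Hcos : cos del = 1 - eta / 2) by (apply cos_acos; lra).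
assert (Hdel : 0 < del <= PI / 2).
{ assert (Hb := acos_bound (1 - eta / 2)). fold del in Hb. assert (Hpi := PI_RGT_0). split.
  - destruct (proj1 Hb) as [|He]; auto. rewrite <- He, cos_0 in Hcos. lra.
  - destruct (Rle_dec del (PI / 2)) as [|Hn]; auto.
    assert (cos del <= cos (PI / 2)) by (apply cos_decr_1; lra).
    rewrite cos_PI2 in H. lra. }
assert (Hsum : forall x la, M <= la -> 0 < x ^ 2 + la) by (intros x la Hla; generalize (pow2_ge_0 x); lra).
assert (Hrate := rate_cont M eta Heta HM).
assert (Hrate1 := rate_ge_1 M eta Heta HM).
assert (HdK : forall x, is_derive (fun y => RInt (rate M) 0 y) x (rate M x))
  by (intro; now apply is_derive_RInt_from_0).
destruct (reduced_system_solution (rate M) (fun x => RInt (rate M) 0 x) (lapse_coeff M w)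
   (drift_coeff M) (fun x => / (x ^ 2 + M)) (metric_ratio M) M eta del)
  as [eps [th [L [la [ta [Heps [Hbox [Hth [HL [Hla [Hta [Hlim1 Hlim2]]]]]]]]]]]].
- exact Hrate.
- intro x. generalize (Hrate1 x). lra.
- exact HdK.
- apply RInt_0_0.
- apply (is_lim_le_p_loc (fun x => x)); [|apply is_lim_id].
  exists 0. intros x Hx.
  assert (H : x - RInt (rate M) 0 x <= 0 - RInt (rate M) 0 0); [|rewrite RInt_0_0 in H; lra].
  apply (derive_nonpos_decreasing (fun y => y - RInt (rate M) 0 y) (fun y => 1 - rate M y)); [lra| |].
  + intros y _. apply (is_derive_minus (fun y => y) (fun y => RInt (rate M) 0 y)); [|apply HdK].
    apply (is_derive_id (K := R_AbsRing)).
  + intros y _. generalize (Hrate1 y). lra.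
- exact (lapse_coeff_cont M eta w Heta HM).
- intro x. exact (drift_coeff_cont M x).
- intro x. apply continuous_Rinv_comp; [cont|]. generalize (Hsum x M (Rle_refl M)). lra.
- exact (metric_ratio_cont M eta Heta HM).
- exact HMpos.
- lra.
- exact Hdel.
- exact (lapse_coeff_bounds M eta w Heta HM Hwe).
- exact (drift_coeff_nonneg M eta Heta HM).
- intros x _. assert (H := Hsum x M (Rle_refl M)).
  rewrite Rabs_pos_eq by (left; now apply Rinv_0_lt_compat).
  unfold Rdiv. rewrite Rmult_1_l. apply Rinv_le_contravar; auto. generalize (pow2_ge_0 x). lra.
- exact (metric_ratio_bounds M eta Heta HM).
- exact (metric_ratio_lipschitz M eta Heta HM).
- rewrite Hcos. exact (angle_barrier M eta w Heta HM Hwe).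
- exists eps, M, th, L, la, ta.
  assert (Hval : forall x, 0 < sqrt (x ^ 2 + M) /\ 0 < sqrt (x ^ 2 + la x) /\ 1 <= S4 x /\
     metric_ratio M x (la x) = sqrt (x ^ 2 + M) / sqrt (x ^ 2 + la x) /\
     x ^ 2 + M = sqrt (x ^ 2 + M) ^ 2 /\ 1 + x ^ 4 = S4 x ^ 2).
  { intro x. destruct (Hbox x) as [[H1 _] _].
    split; [|split; [|split; [|split; [|split]]]].
    - apply sqrt_lt_R0, Hsum, Rle_refl.
    - now apply sqrt_lt_R0, Hsum.
    - apply S4_ge_1.
    - exact (metric_ratio_eq M eta Heta HM x (la x) H1).
    - rewrite pow2_sqrt; auto. left. apply Hsum, Rle_refl.
    - replace (S4 x ^ 2) with (S4 x * S4 x) by ring. now rewrite S4_sqr. }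
  split; [exact Heps|]. split.
  { intro x. generalize (Hbox x). lra. }
  split; [|split; [|split; [|split; [|split; [exact Hlim1|exact Hlim2]]]]];
    intros x Hx; destruct (Hval x) as [H1 [H2 [H3 [H4 [H5 H6]]]]].
  + evar_last; [now apply Hth|].
    unfold angle_rhs, rate, lapse_coeff, drift_coeff. rewrite H4, H6. field. lra.
  + evar_last; [now apply HL|]. unfold rate. rewrite H4. field. lra.
  + evar_last; [now apply Hla|]. unfold mass_rhs, rate, lapse_coeff. rewrite H4. field. lra.
  + evar_last; [now apply Hta|]. unfold lapse_rhs, rate, lapse_coeff. rewrite H4.
    rewrite H5 at 2. field. lra.
Qed.

(** * Return to the radial variable *)

Lemma is_derive_comp_sqrt (f : R -> R) (m r l : R) : 0 < m -> 0 < r ->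
  is_derive f (sqrt (m * r)) l ->
  is_derive (fun s => f (sqrt (m * s))) r (m / (2 * sqrt (m * r)) * l).
Proof.
intros Hm Hr Hf. assert (Hmr := Rmult_lt_0_compat m r Hm Hr).
apply (is_derive_comp f (fun s => sqrt (m * s)) r l (m / (2 * sqrt (m * r)))); auto.
auto_derive; [exact Hmr|]. field. apply Rgt_not_eq, sqrt_lt_R0, Hmr.
Qed.

Lemma is_lim_scal_p_infty (m : R) : 0 < m -> is_lim (fun s => m * s) p_infty p_infty.
Proof.
intro Hm. apply is_lim_spec. intro N. exists (N / m). intros x Hx.
replace N with (m * (N / m)) by (field; lra). now apply Rmult_lt_compat_l.
Qed.

Lemma is_lim_comp_sqrt (f : R -> R) (m l : R) : 0 < m ->
  is_lim f p_infty l -> is_lim (fun s => f (sqrt (m * s))) p_infty l.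
Proof.
intros Hm Hf. apply (is_lim_comp f (fun s => sqrt (m * s)) p_infty l p_infty); auto.
- apply is_lim_sqrt_p. now apply is_lim_scal_p_infty.
- exists 0. intros; discriminate.
Qed.

(* [TH] is twice the polar angle of [(Phi1, Phi2)], and [exp LL] is proportional to
   [Phi1^2 + Phi2^2]; moreover [A = a^2] and [T = TA / a]. *)
Lemma radial_solution (m w : R) : 0 < m -> 0 < w < 1 -> exists (eps M : R) (TH LL LA TA : R -> R),
  0 < eps /\
  (forall r, 0 < LA r /\ 0 < TA r) /\
  (forall r, 0 < r -> exists a th,
     a = sqrt (1 + LA r / (m * r)) /\ 0 < a /\ th = TH r - atan (/ (m * r)) /\
     is_derive TH r (2 * m * (w * TA r / a ^ 2 - S4 (sqrt (m * r)) * cos th / (m * r * a))) /\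
     is_derive LL r (- (2 * m * (S4 (sqrt (m * r)) * sin th) / (m * r * a))) /\
     is_derive LA r (- (2 * m * eps * w * TA r ^ 2 * exp (LL r) / a ^ 2)) /\
     is_derive TA r (m * eps * exp (LL r) *
       (S4 (sqrt (m * r)) * cos th * TA r ^ 2 / ((m * r) ^ 2 * a ^ 3) - 2 * w * TA r ^ 3 / (m * r * a ^ 4)))) /\
  is_lim LA p_infty M /\ is_lim TA p_infty 1.
Proof.
intros Hm Hw.
destruct (unit_mass_solution w Hw)
  as [eps [M [th [L [la [ta [Heps [Hpos [Hth [HL [Hla [Hta [Hlim1 Hlim2]]]]]]]]]]]]].
exists eps, M, (fun r => th (sqrt (m * r)) + atan (/ (m * r))), (fun r => L (sqrt (m * r))),
  (fun r => la (sqrt (m * r))), (fun r => ta (sqrt (m * r))).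
split; [exact Heps|]. split; [auto|]. split; [|split; apply is_lim_comp_sqrt; auto].
intros r Hr. assert (Hmr := Rmult_lt_0_compat m r Hm Hr).
set (x := sqrt (m * r)).
assert (Hx : 0 < x) by now apply sqrt_lt_R0.
assert (Hx2 : m * r = x ^ 2) by (unfold x; rewrite pow2_sqrt; lra).
destruct (Hpos x) as [Hla0 Hta0].
assert (HB : 0 < sqrt (x ^ 2 + la x)) by (apply sqrt_lt_R0; rewrite <- Hx2; lra).
assert (Hquot : 0 < 1 + la x / (m * r)).
{ assert (0 < la x / (m * r)) by now apply Rdiv_lt_0_compat. lra. }
assert (Ha : 0 < sqrt (1 + la x / (m * r))) by now apply sqrt_lt_R0.
assert (HBa : sqrt (x ^ 2 + la x) = x * sqrt (1 + la x / (m * r))).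
{ replace (x ^ 2 + la x) with (x ^ 2 * (1 + la x / (m * r))) by (rewrite Hx2; field; lra).
  rewrite sqrt_mult, sqrt_pow2; lra. }
exists (sqrt (1 + la x / (m * r))), (th x).
set (a := sqrt (1 + la x / (m * r))) in *.
specialize (Hth x Hx). specialize (HL x Hx). specialize (Hla x Hx). specialize (Hta x Hx).
rewrite HBa in Hth, HL, Hla, Hta.
split; [reflexivity|]. split; [exact Ha|]. split; [fold x; ring|].
split; [|split; [|split]].
- evar_last.
  + apply (is_derive_plus (fun r => th (sqrt (m * r))) (fun r => atan (/ (m * r)))).
    * apply is_derive_comp_sqrt; eauto.
    (* This derivative of the reference direction cancels the drift term of [th]. *)
    * assert (H : is_derive (fun r => atan (/ (m * r))) r (- (m / (1 + (m * r) ^ 2)))); [|exact H].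
      auto_derive; [lra|]. field. split; nra.
  + fold x. change plus with Rplus. rewrite Hx2. assert (H := one_plus_pow4_ge x).
    replace ((x ^ 2) ^ 2) with (x ^ 4) by ring. field. lra.
- evar_last; [apply is_derive_comp_sqrt; eauto|]. fold x. rewrite Hx2. field. lra.
- evar_last; [apply is_derive_comp_sqrt; eauto|]. fold x. field. lra.
- evar_last; [apply is_derive_comp_sqrt; eauto|]. fold x. rewrite Hx2. field. lra.
Qed.

(** In the right triangle with legs [y] and [1] the hypotenuse is [S4 (sqrt y)] and the angle
    opposite to [1] is [atan (/ y)]. *)
Lemma S4_rotation (y psi : R) : 0 < y ->
  S4 (sqrt y) * cos (psi - atan (/ y)) = y * cos psi + sin psi /\
  S4 (sqrt y) * sin (psi - atan (/ y)) = y * sin psi - cos psi.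
Proof.
intro Hy.
assert (H4 : sqrt y ^ 4 = y ^ 2).
{ replace (sqrt y ^ 4) with ((sqrt y ^ 2) ^ 2) by ring. rewrite pow2_sqrt; lra. }
assert (H : S4 (sqrt y) = y * sqrt (1 + (/ y)²)).
{ unfold S4. rewrite H4. replace (1 + y ^ 2) with (y ^ 2 * (1 + (/ y)²)) by (unfold Rsqr; field; lra).
  rewrite sqrt_mult, sqrt_pow2; auto; try lra; [apply pow2_ge_0|]. generalize (Rle_0_sqr (/ y)). lra. }
assert (H0 : 0 < sqrt (1 + (/ y)²)) by (apply sqrt_lt_R0; generalize (Rle_0_sqr (/ y)); lra).
rewrite H, cos_minus, sin_minus, cos_atan, sin_atan.
split; field; lra.
Qed.

(** * Assembly of the Einstein-Dirac solution *)

(** Any [Derive g] at the point of [H] is matched, and conversion decides whether [H] applies; the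
    terms left by [auto_derive] need not agree with [H] syntactically. *)
Ltac rewrite_derive H :=
  match type of H with
  | is_derive _ ?x ?l =>
      repeat match goal with
        | |- context [Derive ?g x] =>
            replace (Derive g x) with l by (symmetry; apply is_derive_unique; exact H)
        end
  end.

Theorem theorem1p1 :
  forall m : R, 0 < m ->
  exists eps0 : R, 0 < eps0 /\
    forall omega : R, 0 < omega -> omega < m -> m - omega < eps0 ->
    exists Phi1 Phi2 A T : R -> R,
      ~ ((forall r, 0 < r -> Phi1 r = 0) /\ (forall r, 0 < r -> Phi2 r = 0)) /\
      is_einstein_dirac_solution m omega Phi1 Phi2 A T /\
      asymptotically_minkowskian T /\
      finite_adm_mass A.
Proof.
intros m Hm. exists 1. split; [lra|]. intros omega Ho Hom _.
assert (Hw : 0 < omega / m < 1).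
{ split; [now apply Rdiv_lt_0_compat|]. apply Rmult_lt_reg_r with m; auto.
  unfold Rdiv. rewrite Rmult_assoc, Rinv_l; lra. }
destruct (radial_solution m (omega / m) Hm Hw)
  as [eps [M [TH [LL [LA [TA [Heps [Hpos [Hsol [Hlim1 Hlim2]]]]]]]]]].
assert (Hpi := PI_RGT_0).
(* The amplitude for which the density [kap^2 exp LL] enters the Einstein equations with coupling
   [eps]: comparing sources gives [2 eps / m = 16 PI kap^2]. *)
set (kap := sqrt (eps / (8 * PI * m))).
assert (Hk : 0 < eps / (8 * PI * m)) by (apply Rdiv_lt_0_compat; [|apply Rmult_lt_0_compat]; lra).
assert (Hkap : 0 < kap) by now apply sqrt_lt_R0.
assert (Hkap2 : eps = 8 * PI * m * kap ^ 2).
{ unfold kap. rewrite pow2_sqrt by lra. field. lra. }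
set (Phi1 := fun r => kap * exp (LL r / 2) * cos (TH r / 2)).
set (Phi2 := fun r => kap * exp (LL r / 2) * sin (TH r / 2)).
set (A := fun r => 1 + LA r / (m * r)).
set (T := fun r => TA r / sqrt (A r)).
assert (Hall : forall r, 0 < r -> exists dP1 dP2 dA dT,
  0 < A r /\ 0 < T r /\
  is_derive Phi1 r dP1 /\ is_derive Phi2 r dP2 /\ is_derive A r dA /\ is_derive T r dT /\
  sqrt (A r) * dP1 = 1 / r * Phi1 r - (omega * T r + m) * Phi2 r /\
  sqrt (A r) * dP2 = (omega * T r - m) * Phi1 r - 1 / r * Phi2 r /\
  r * dA = 1 - A r - 16 * PI * omega * (T r) ^ 2 * ((Phi1 r) ^ 2 + (Phi2 r) ^ 2) /\
  2 * r * A r * (dT / T r)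
    = A r - 1 - 16 * PI * omega * (T r) ^ 2 * ((Phi1 r) ^ 2 + (Phi2 r) ^ 2)
      + 32 * PI * (1 / r) * T r * Phi1 r * Phi2 r
      + 16 * PI * m * T r * ((Phi1 r) ^ 2 - (Phi2 r) ^ 2)).
{ intros r Hr. assert (Hmr := Rmult_lt_0_compat m r Hm Hr).
  destruct (Hsol r Hr) as [a [th [Ha [Ha0 [Hth [HTH [HLL [HLA HTA]]]]]]]].
  destruct (Hpos r) as [HLA0 HTA0].
  destruct (S4_rotation (m * r) (TH r) Hmr) as [Hc Hs]. rewrite <- Hth in Hc, Hs.
  rewrite Hc in HTH, HTA. rewrite Hs in HLL.
  assert (HA : A r = a ^ 2).
  { rewrite Ha. unfold A. rewrite pow2_sqrt; auto.
    assert (0 < LA r / (m * r)) by now apply Rdiv_lt_0_compat. lra. }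
  assert (HsA : sqrt (A r) = a) by (unfold A; now rewrite <- Ha).
  set (dTH := 2 * m * (omega / m * TA r / a ^ 2 - (m * r * cos (TH r) + sin (TH r)) / (m * r * a))) in *.
  set (dLL := - (2 * m * (m * r * sin (TH r) - cos (TH r)) / (m * r * a))) in *.
  set (dLA := - (2 * m * eps * (omega / m) * TA r ^ 2 * exp (LL r) / a ^ 2)) in *.
  set (dTA := m * eps * exp (LL r) * ((m * r * cos (TH r) + sin (TH r)) * TA r ^ 2 /
      ((m * r) ^ 2 * a ^ 3) - 2 * (omega / m) * TA r ^ 3 / (m * r * a ^ 4))) in *.
  set (dA := dLA / (m * r) - LA r / (m * r ^ 2)).
  assert (HdA : is_derive A r dA).
  { unfold A. auto_derive.
    - repeat split; [now exists dLA|lra].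
    - rewrite_derive HLA. unfold dA. field. lra. }
  assert (HA0 : 0 < A r) by (rewrite HA; apply pow_lt, Ha0).
  set (dT := dTA / a - TA r * dA / (2 * a ^ 3)).
  assert (HdT : is_derive T r dT).
  { unfold T. auto_derive.
    - repeat split; [now exists dTA|now exists dA|exact HA0|rewrite HsA; lra].
    - rewrite_derive HTA. rewrite_derive HdA.
      rewrite HsA. unfold dT. field. lra. }
  set (C := cos (TH r)) in *. set (S := sin (TH r)) in *.
  set (c := cos (TH r / 2)). set (s := sin (TH r / 2)).
  assert (HC : C = c ^ 2 - s ^ 2).
  { unfold C, c, s. replace (TH r) with (2 * (TH r / 2)) at 1 by field. rewrite cos_2a. ring. }
  assert (HS : S = 2 * s * c).
  { unfold S, c, s. replace (TH r) with (2 * (TH r / 2)) at 1 by field. apply sin_2a. }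
  assert (Hcs : s ^ 2 + c ^ 2 = 1).
  { generalize (sin2_cos2 (TH r / 2)). unfold Rsqr, s, c. lra. }
  (* The addition formulas for [TH - TH / 2]; they bring the doubled angle back to the angle of the
     spinor. *)
  assert (HE1 : C * c + S * s = c).
  { rewrite HC, HS. transitivity (c * (s ^ 2 + c ^ 2)); [ring|rewrite Hcs; ring]. }
  assert (HE2 : S * c - C * s = s).
  { rewrite HC, HS. transitivity (s * (s ^ 2 + c ^ 2)); [ring|rewrite Hcs; ring]. }
  assert (HaL : a * dLL = 2 * (C / r - m * S)) by (unfold dLL; field; lra).
  assert (HaT : a * dTH = 2 * (omega * T r - m * C - S / r)).
  { unfold dTH, T. rewrite HsA. field. lra. }
  assert (HE : exp (LL r) = exp (LL r / 2) ^ 2).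
  { replace (LL r) with (LL r / 2 + LL r / 2) at 1 by field. rewrite exp_plus. ring. }
  exists (dLL / 2 * Phi1 r - dTH / 2 * Phi2 r), (dLL / 2 * Phi2 r + dTH / 2 * Phi1 r), dA, dT.
  split; [exact HA0|]. split; [unfold T; rewrite HsA; now apply Rdiv_lt_0_compat|].
  split; [|split; [|split; [exact HdA|split; [exact HdT|split; [|split; [|split]]]]]].
  - unfold Phi1, Phi2. auto_derive.
    + repeat split; [now exists dLL|now exists dTH].
    + rewrite_derive HLL. rewrite_derive HTH.
      unfold Rdiv. ring.
  - unfold Phi1, Phi2. auto_derive.
    + repeat split; [now exists dLL|now exists dTH].
    + rewrite_derive HLL. rewrite_derive HTH.
      unfold Rdiv. ring.
  - rewrite HsA. transitivity ((a * dLL) / 2 * Phi1 r - (a * dTH) / 2 * Phi2 r); [field|].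
    rewrite HaL, HaT. unfold Phi1, Phi2. fold c s. set (e := kap * exp (LL r / 2)).
    transitivity (e * ((C * c + S * s) / r - m * (S * c - C * s) - omega * T r * s)); [field; lra|].
    rewrite HE1, HE2. field. lra.
  - rewrite HsA. transitivity ((a * dLL) / 2 * Phi2 r + (a * dTH) / 2 * Phi1 r); [field|].
    rewrite HaL, HaT. unfold Phi1, Phi2. fold c s. set (e := kap * exp (LL r / 2)).
    transitivity (e * (- (S * c - C * s) / r - m * (C * c + S * s) + omega * T r * c)); [field; lra|].
    rewrite HE1, HE2. field. lra.
  - assert (HN : Phi1 r ^ 2 + Phi2 r ^ 2 = kap ^ 2 * exp (LL r)).
    { unfold Phi1, Phi2. fold c s. rewrite HE.
      transitivity (kap ^ 2 * exp (LL r / 2) ^ 2 * (s ^ 2 + c ^ 2)); [ring|rewrite Hcs; ring]. }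
    rewrite HN. unfold T. rewrite HsA. unfold dA, dLA, A. rewrite Hkap2. field. lra.
  - assert (HN : Phi1 r ^ 2 + Phi2 r ^ 2 = kap ^ 2 * exp (LL r)).
    { unfold Phi1, Phi2. fold c s. rewrite HE.
      transitivity (kap ^ 2 * exp (LL r / 2) ^ 2 * (s ^ 2 + c ^ 2)); [ring|rewrite Hcs; ring]. }
    assert (HD : Phi1 r ^ 2 - Phi2 r ^ 2 = kap ^ 2 * exp (LL r) * C).
    { unfold Phi1, Phi2. fold c s. rewrite HE, HC. ring. }
    assert (HP : T r * Phi1 r * Phi2 r = T r * (kap ^ 2 * exp (LL r) * (S / 2))).
    { unfold Phi1, Phi2. fold c s. rewrite HE, HS. field. }
    assert (HrA : r * dA = 1 - A r - 16 * PI * omega * T r ^ 2 * (kap ^ 2 * exp (LL r))).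
    { unfold T. rewrite HsA. unfold dA, dLA, A. rewrite Hkap2. field. lra. }
    rewrite HN, HD.
    replace (32 * PI * (1 / r) * T r * Phi1 r * Phi2 r)
      with (32 * PI * (1 / r) * (T r * Phi1 r * Phi2 r)) by ring.
    rewrite HP.
    (* As [TA = sqrt A * T], the logarithmic derivative of [T] splits into that of [TA] and the
       first Einstein equation. *)
    transitivity (2 * r * a ^ 2 * (dTA / TA r) - r * dA).
    { rewrite HA. unfold dT, T. rewrite HsA. field. lra. }
    rewrite HrA. unfold dTA, T. rewrite HsA, Hkap2. field. lra. }
exists Phi1, Phi2, A, T.
split; [|split; [|split]].
- intros [H1 H2]. specialize (H1 1 Rlt_0_1). specialize (H2 1 Rlt_0_1).
  unfold Phi1 in H1. unfold Phi2 in H2.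
  assert (He := Rmult_lt_0_compat _ _ Hkap (exp_pos (LL 1 / 2))).
  assert (Hsc := sin2_cos2 (TH 1 / 2)).
  apply Rmult_integral in H1. apply Rmult_integral in H2.
  destruct H1 as [H1|H1], H2 as [H2|H2]; try lra.
  rewrite H1, H2 in Hsc. unfold Rsqr in Hsc. lra.
- constructor; intros r Hr;
    destruct (Hall r Hr) as [dP1 [dP2 [dA [dT [H1 [H2 [H3 [H4 [H5 [H6 [H7 [H8 [H9 H10]]]]]]]]]]]]];
    rewrite ?(is_derive_unique _ _ _ H3), ?(is_derive_unique _ _ _ H4),
      ?(is_derive_unique _ _ _ H5), ?(is_derive_unique _ _ _ H6); auto;
    [exists dP1|exists dP2|exists dA|exists dT]; assumption.
- unfold asymptotically_minkowskian, T.
  assert (Hinv : is_lim A p_infty 1).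
  { replace (Finite 1) with (Finite (1 + M * 0)) by (f_equal; ring).
    apply (is_lim_plus' (fun _ => 1) (fun r => LA r / (m * r))); [apply is_lim_const|].
    apply (is_lim_mult LA (fun r => / (m * r)) p_infty M 0); [exact Hlim1| |exact I].
    apply (is_lim_inv (fun r => m * r) p_infty p_infty); [now apply is_lim_scal_p_infty|discriminate]. }
  assert (Hsqrt : is_lim (fun r => sqrt (A r)) p_infty 1).
  { rewrite <- sqrt_1. apply (is_lim_comp_continuous A sqrt p_infty 1 Hinv), continuous_sqrt. }
  replace (Finite 1) with (Finite (1 * / 1)) by (f_equal; field).
  apply (is_lim_mult TA (fun r => / sqrt (A r)) p_infty 1 (/ 1)); [exact Hlim2| |exact I].
  apply (is_lim_inv (fun r => sqrt (A r)) p_infty 1); auto. intro H. injection H. lra.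
(* The mass function is exactly [- LA r / (2 * m)], so its limit is negative. *)
- exists (- M / (2 * m)).
  apply (is_lim_ext_loc (fun r => - / (2 * m) * LA r)).
  + exists 0. intros r Hr. unfold A. field. lra.
  + replace (- M / (2 * m)) with (- / (2 * m) * M) by (field; lra).
    now apply (is_lim_scal_l LA (- / (2 * m)) p_infty M).
Qed.
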